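(* Let $\Delta$ be an irreducible (finite reduced) root system of rank $r$. Let $k_\alpha\in\mathbb{Z}_{\ge1}$ ($\alpha\in\Delta$) depend only on the length $\|\alpha\|$, $k_\alpha=k_{\|\alpha\|}$, and put $\mathbf{k}=(k_\alpha)_{\alpha\in\Delta_+}$. Then $$\zeta_r(2\mathbf{k};\Delta)=\frac{(-1)^{\lvert\Delta_+\rvert}}{\lvert W\rvert}\biggl(\prod_{\alpha\in\Delta_+}\frac{(2\pi\sqrt{-1})^{2k_\alpha}}{(2k_\alpha)!}\biggr)B_{2\mathbf{k}}(\Delta)\in\mathbb{Q}\,\pi^{2\sum_lk_l\lvert(\Delta_+)_l\rvert},$$ where $l$ runs over the lengths of roots and $(\Delta_+)_l=\{\alpha\in\Delta_+:\|\alpha\|=l\}$.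
   Context: Root systems: $V$ is an $r$-dimensional real inner product space, $V^*$ is identified with $V$; $\Delta\subset V$ a root system, $\Psi=\{\alpha_1,\dots,\alpha_r\}$ a fundamental system, $\Delta_+$ the positive roots, $\alpha^\vee$ the coroot of $\alpha$, $W$ the Weyl group; fundamental weights $\lambda_j$ satisfy $\langle\alpha_i^\vee,\lambda_j\rangle=\delta_{ij}$; $P_{++}=\{\sum_im_i\lambda_i:m_i\in\mathbb{Z}_{\ge1}\}$. The zeta-function of the root system is $\zeta_r(\mathbf{s};\Delta)=\sum_{\lambda\in P_{++}}\prod_{\alpha\in\Delta_+}\langle\alpha^\vee,\lambda\rangle^{-s_\alpha}$ for $\mathbf{s}=(s_\alpha)_{\alpha\in\Delta_+}$ with $\Re s_\alpha>1$. The Bernoulli numbers of $\Delta$ are, for $\mathbf{k}\in\mathbb{Z}_{\ge0}^{|\Delta_+|}$, $$B_{\mathbf{k}}(\Delta)=\int_0^1\!\!\cdots\!\int_0^1\Bigl(\prod_{\alpha\in\Delta_+\setminus\Psi}B_{k_\alpha}(x_\alpha)\Bigr)\biggl(\prod_{i=1}^rB_{k_{\alpha_i}}\Bigl(\Bigl\{-\sum_{\alpha\in\Delta_+\setminus\Psi}x_\alpha\langle\alpha^\vee,\lambda_i\rangle\Bigr\}\Bigr)\biggr)\prod_{\alpha\in\Delta_+\setminus\Psi}dx_\alpha,$$ with $B_k(x)$ the $k$-th Bernoulli polynomial and $\{x\}=x-[x]$ (for $\Delta_+\setminus\Psi=\emptyset$ the integral is the value of the integrand). *)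

(* Defs.v *)
From mathcomp Require Export all_boot all_order all_algebra finmap.
From mathcomp Require Export complex sesquilinear.
From mathcomp Require Export all_classical all_reals all_analysis.
From mathcomp.analysis.showcase Require summability.

Set Implicit Arguments.
Unset Strict Implicit.
Unset Printing Implicit Defensive.

Export Order.TTheory GRing.Theory Num.Theory.
Export numFieldNormedType.Exports.
Local Open Scope classical_set_scope.
Local Open Scope ring_scope.

(* The list B_0, ..., B_(n-1) of Bernoulli numbers (B_1 = -1/2), obtained by
   solving [bernoulli_rec] below for its last term. *)
Fixpoint bernoulli_seq (n : nat) : seq rat :=
  if n is m.+1 then
    let s := bernoulli_seq m in
    rcons s ((m == 0)%:R - (\sum_(j < m) 'C(m.+1, j)%:R * s`_j) / m.+1%:R)
  else [::].

Definition bernoulli (n : nat) : rat := (bernoulli_seq n.+1)`_n.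

Definition bernoulli_poly (k : nat) : {poly rat} :=
  \poly_(i < k.+1) ('C(k, i)%:R * bernoulli (k - i)).

Definition bernoulli_fun (R : realType) (k : nat) (x : R) : R :=
  (map_poly ratr (bernoulli_poly k)).[x].

Lemma size_bernoulli_seq n : size (bernoulli_seq n) = n.
Proof. by elim: n => //= n IHn; rewrite size_rcons IHn. Qed.

Lemma nth_bernoulli_seq n j : (j < n)%N -> (bernoulli_seq n)`_j = bernoulli j.
Proof.
elim: n => // n IHn; rewrite ltnS leq_eqVlt => /predU1P[-> // | ltjn].
by rewrite -(IHn ltjn) /= nth_rcons size_bernoulli_seq ltjn.
Qed.

Lemma bernoulli_rec n :
  \sum_(j < n.+1) 'C(n.+1, j)%:R * bernoulli j = (n == 0)%:R.
Proof.
have nz : n.+1%:R != 0 :> rat by rewrite pnatr_eq0.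
rewrite big_ord_recr /= binSn /bernoulli /= nth_rcons size_bernoulli_seq.
rewrite ltnn eqxx mulrBr mulrCA mulfV // mulr1.
under [X in _ - X]eq_bigr => j _ do rewrite (nth_bernoulli_seq (ltn_ord j)).
by rewrite addrC subrK; case: eqP => [->|_]; rewrite ?mulr1 ?mulr0.
Qed.

Definition frac_part (R : realType) (x : R) : R := x - (Num.floor x)%:~R.

(* a ^ s = exp (s ln a), for a positive real a and a complex s. *)
Definition cpow (R : realType) (a : R) (s : R[i]) : R[i] :=
  (a `^ complex.Re s)%:C%C *
  (cos (complex.Im s * ln a) +i* sin (complex.Im s * ln a))%C.

Section RootSystem.
Variables (R : realType) (V : vectType R) (ip : {dot V for @idfun R}).
Implicit Types (a b v : V) (Delta : {fset V}).

Definition vlength v : R := Num.sqrt (ip v v).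

Definition coroot a : V := (2 / ip a a) *: a.

Definition reflection a v : V := v - ip (coroot a) v *: a.

Lemma reflection_is_linear a : linear (reflection a).
Proof.
move=> c u v; rewrite /reflection linearDr linearZr /= scalerBr scalerDl.
by rewrite scalerA opprD addrACA.
Qed.

(* Finite, reduced, crystallographic root system spanning V. *)
Definition root_system Delta : Prop :=
  [/\ <<Delta>>%VS = fullv,
      0 \notin Delta,
      forall a b, a \in Delta -> b \in Delta -> reflection a b \in Delta,
      forall a b, a \in Delta -> b \in Delta -> ip (coroot a) b \is a Num.int
    & forall a (c : R), a \in Delta -> c *: a \in Delta -> c = 1 \/ c = -1].

Definition irreducible_roots Delta : Prop :=
  Delta != fset0 /\
  forall A B : {fset V},
    (A `|` B)%fset = Delta ->
    (forall a b, a \in A -> b \in B -> ip a b = 0) ->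
    A = fset0 \/ B = fset0.

Definition nonneg_comb r (Psi : r.-tuple V) v : Prop :=
  exists m : 'I_r -> nat, v = \sum_i tnth Psi i *+ m i.

Definition fundamental_system Delta r (Psi : r.-tuple V) : Prop :=
  [/\ basis_of fullv Psi,
      {subset Psi <= Delta}
    & forall a, a \in Delta -> nonneg_comb Psi a \/ nonneg_comb Psi (- a)].

Definition positive_roots Delta r (Psi : r.-tuple V) : {fset V} :=
  [fset a in Delta | `[< nonneg_comb Psi a >]]%fset.

Definition nonsimple_roots Delta r (Psi : r.-tuple V) : {fset V} :=
  [fset a in positive_roots Delta Psi | a \notin Psi]%fset.

Definition fundamental_weights r (Psi lambda : r.-tuple V) : Prop :=
  forall i j, ip (coroot (tnth Psi i)) (tnth lambda j) = (i == j)%:R.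

(* Reflections being involutions, closing under them yields the whole group. *)
Inductive weyl_group Delta : set 'End(V) :=
| weyl_id : weyl_group Delta \1%VF
| weyl_reflection a w : a \in Delta -> weyl_group Delta w ->
    weyl_group Delta (linfun (reflection a) \o w)%VF.

Definition weyl_order Delta : nat := #|` fset_set (weyl_group Delta)|.

Definition regular_dominant_weights r (lambda : r.-tuple V) : set V :=
  [set v | exists2 m : 'I_r -> nat,
     (forall i, (1 <= m i)%N) & v = \sum_i tnth lambda i *+ m i].

(* The unordered sum over P_{++} (the regular dominant weights), that is, the
   limit of the sums over finite sets of weights; the series converges when
   Re s_a > 1 for all positive roots a. *)
Definition zeta_roots Delta r (Psi lambda : r.-tuple V) (s : V -> R[i]) :
    R[i] :=
  @summability.sum V R[i] R[i]^o (fun v =>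
    if v \in regular_dominant_weights lambda then
      \prod_(a <- positive_roots Delta Psi) cpow (ip (coroot a) v) (- s a)
    else 0).

(* Integrates F over [0, 1] in each of the coordinates listed in s, one
   coordinate at a time; coordinates outside s are set to 0. *)
Fixpoint iterated_integral (s : seq V) (F : (V -> R) -> R) : R :=
  if s is a :: s' then
    \int[lebesgue_measure]_(t in `[0, 1])
      iterated_integral s' (fun x => F (fun b => if b == a then t else x b))
  else F (fun=> 0).

Definition bernoulli_roots Delta r (Psi lambda : r.-tuple V) (k : V -> nat) :
    R :=
  let N := nonsimple_roots Delta Psi in
  iterated_integral N (fun x =>
    (\prod_(a <- N) bernoulli_fun (k a) (x a)) *
    \prod_(i < r) bernoulli_fun (k (tnth Psi i))
      (frac_part (- \sum_(a <- N) x a * ip (coroot a) (tnth lambda i)))).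

Definition root_lengths Delta : {fset R} := [fset vlength a | a in Delta]%fset.

Definition roots_of_length (A : {fset V}) (l : R) : {fset V} :=
  [fset a in A | vlength a == l]%fset.

End RootSystem.

(* Main.v *)
(** The Bernoulli function [B_(2k)({x})] is a constant times the sum over m <> 0 of
    [m^(-2k) e^(2 pi i m x)], uniformly in x.  Inserting these series in the
    integral defining [B_(2k)(Delta)], orthogonality of characters leaves the sum of
    [prod_(a > 0) <a^, v>^(-2 k_a)] over all weights v lying on no root hyperplane,
    because [a^ = sum_i <a^, lambda_i> a_i^] with integral coefficients.  The Weyl
    group acts simply transitively on the chambers and preserves the summand, so
    this sum is |W| times the zeta value.  The truncation |m| <= M of all the
    Fourier series at once selects the W-stable finite set of weights with
    |<a^, v>| <= M for every root a: the identity is exact at each level M and only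
    sums of nonnegative reals pass to the limit.

    For rationality, functions generated over Q by the fractional parts of rational
    affine forms are stable under integration over one variable t: two sawtooth
    functions u = {t/Q + z}, v = {t/Q + w} satisfy [v - u + {z - w} \in {0, 1}], which
    turns any product of such functions into a combination of powers of single
    ones, and these are integrated explicitly. *)
From HB Require Import structures.
Require Import Defs.
From mathcomp Require Import measurable_realfun ring lra zify.
Set Implicit Arguments.
Unset Strict Implicit.
Unset Printing Implicit Defensive.
Local Open Scope classical_set_scope.
Local Open Scope ring_scope.

(** * Bernoulli polynomials *)

(** The error [B_k - S_k] of a truncated Fourier series has as derivative [k] times the error of
    degree [k - 1], and in degree 0 it is the Dirichlet kernel. In degree 1 it is small only away
    from the integers, where the sawtooth jumps; this still makes the error of degree 2 nearly
    constant on the open unit interval, and a zero supplied by Rolle's theorem turns small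
    oscillation into small size. All higher degrees inherit the rate 1/M.

    Linearity of iterated integrals requires integrability at every level. The algebra of fractional
    parts that yields rationality provides this as well, once its constants may be arbitrary reals:
    fixing a coordinate at a real number leaves the rational algebra.

    The convention [0^-1 = 0] removes the zero frequency and the weights on root hyperplanes without
    case distinctions. The Weyl group, defined by all reflections, is handled through words in the
    simple ones: an extremal pairing with a strictly dominant vector moves a regular vector into the
    chamber, and shortening of words gives uniqueness. *)

Lemma coef_bernoulli_poly k i : (bernoulli_poly k)`_i =
  if (i <= k)%N then 'C(k, i)%:R * bernoulli (k - i) else 0.
Proof. by rewrite coef_poly ltnS. Qed.

Lemma deriv_bernoulli_poly k :
  (bernoulli_poly k.+1)^`()%R = k.+1%:R *: bernoulli_poly k.
Proof.
apply/polyP => i; rewrite coef_deriv coefZ !coef_bernoulli_poly ltnS.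
case: ifP => [ik|_]; last by rewrite mul0rn mulr0.
rewrite -mulrnAl -mulrnA mulnC subSS mulrA; congr (_ * _).
by rewrite -natrM -mul_bin_diag.
Qed.

(** The sum of the nonconstant coefficients, read in reverse order, is the recursion
    [bernoulli_rec]. *)
Lemma bernoulli_poly_endpoints k :
  (bernoulli_poly k).[1] = (bernoulli_poly k).[0] + (k == 1)%:R.
Proof.
rewrite horner_coef0 coef_bernoulli_poly leq0n bin0 subn0 mul1r.
rewrite horner_coef (big_ord_widen k.+1 (fun i => (bernoulli_poly k)`_i * 1 ^+ i)) ?size_poly //.
rewrite big_mkcond /= (eq_bigr (fun i : 'I_k.+1 => 'C(k, i)%:R * bernoulli (k - i))); last first.
  move=> i _; rewrite expr1n mulr1; case: ifP => [_|/negbT].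
    by rewrite coef_bernoulli_poly -ltnS ltn_ord.
  by rewrite -leqNgt => /leq_sizeP/(_ i (leqnn _)) <-; rewrite coef_bernoulli_poly -ltnS ltn_ord.
rewrite big_ord_recl /= bin0 subn0 mul1r; congr (_ + _).
case: k => [|k]; first by rewrite big_ord0.
rewrite eqSS -bernoulli_rec (reindex_inj rev_ord_inj); apply: eq_bigr => i _ /=.
rewrite /bump /= add1n -subSn ?leq_ord // subSS.
rewrite bin_sub; last by rewrite (leq_trans (ltnW (ltn_ord i))).
by rewrite subKn // ltnW.
Qed.

(** By induction the defect [d] has derivative 0, hence is constant, and it vanishes at 0 by the
    comparison of the endpoint values. *)
Lemma bernoulli_poly_shift k :
  bernoulli_poly k \Po ('X + 1) = bernoulli_poly k + 'X^(k.-1) *+ k.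
Proof.
elim: k => [|k IHk].
  rewrite mulr0n addr0; suff -> : bernoulli_poly 0 = 1%:P by rewrite comp_polyC.
  apply/polyP => i; rewrite coef_bernoulli_poly coefC leqn0; case: eqP => // ->.
  by rewrite bin0 subn0 mul1r /bernoulli /= big_ord0 mul0r subr0.
set d := bernoulli_poly k.+1 \Po ('X + 1) - (bernoulli_poly k.+1 + 'X^k *+ k.+1).
suff /eqP : d = 0 by rewrite subr_eq0 => /eqP.
have d0 : d.[0] = 0.
  rewrite /d !(hornerE, horner_comp) hornerMn hornerXn bernoulli_poly_endpoints eqSS.
  by case: k {IHk d} => [|k]; rewrite ?expr0 ?expr0n /=; ring.
have dd : d^`()%R = 0.
  rewrite /d derivB deriv_comp !derivD derivMn derivXn derivX derivC addr0 mulr1.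
  rewrite deriv_bernoulli_poly comp_polyZ IHk.
  by rewrite scalerDr !scaler_nat mulrnAC; apply: subrr.

have szd : (size d <= 1)%N.
  apply/leq_sizeP => -[//|j] _; have := congr1 (fun p : {poly rat} => p`_j) dd.
  by rewrite coef_deriv coef0 => /eqP; rewrite mulrn_eq0 /= => /eqP.
by rewrite (size1_polyC szd) -horner_coef0 d0.
Qed.

Section BernoulliFun.
Variable R : realType.
Implicit Types (k M : nat) (x : R).

Lemma bernoulli_fun_shift k x :
  bernoulli_fun k (x + 1) = bernoulli_fun k x + k%:R * x ^+ k.-1.
Proof.
rewrite /bernoulli_fun.
have := congr1 (map_poly (@ratr R)) (bernoulli_poly_shift k).
rewrite map_comp_poly !rmorphD rmorphMn /= map_polyXn map_polyX rmorph1.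
move=> /(congr1 (fun p => p.[x])).
by rewrite horner_comp !hornerE hornerMn hornerXn mulr_natl.
Qed.

Lemma bernoulli_fun1 k : bernoulli_fun k 1 = bernoulli_fun k 0 + (k == 1)%:R :> R.
Proof.
rewrite -[X in bernoulli_fun k X = _]add0r bernoulli_fun_shift.
by case: k => [|[|k]] /=; rewrite ?mul0r ?expr0n ?mulr0 ?mulr1.
Qed.

Lemma is_derive_bernoulli_fun k x :
  is_derive x 1 (bernoulli_fun k.+1 : R -> R) (k.+1%:R * bernoulli_fun k x).
Proof.
have := is_derive_poly (map_poly ratr (bernoulli_poly k.+1)) x.
rewrite deriv_map deriv_bernoulli_poly.
by rewrite map_polyZ hornerZ /= ratr_nat.
Qed.

Lemma bernoulli_fun0 x : bernoulli_fun 0 x = 1.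
Proof.
rewrite /bernoulli_fun (_ : bernoulli_poly 0 = 1) ?rmorph1 ?hornerC //.
apply/polyP => i; rewrite coef_bernoulli_poly coefC leqn0; case: eqP => // ->.
by rewrite bin0 subn0 mul1r /bernoulli /= big_ord0 mul0r subr0.
Qed.

Lemma bernoulli_fun1E x : bernoulli_fun 1 x = x - 1 / 2.
Proof.
rewrite /bernoulli_fun (_ : bernoulli_poly 1 = 'X - (1 / 2)%:P).
  by rewrite rmorphB /= map_polyX map_polyC /= hornerXsubC fmorph_div rmorph1 rmorph_nat.
apply/polyP => i; rewrite coef_bernoulli_poly coefB coefX coefC.
case: i => [|[|i]] /=; last by rewrite subr0.
  by rewrite bin0 subn0 /bernoulli /= !big_ord_recr !big_ord0 /=.
by rewrite binn subnn /bernoulli /= big_ord0 mul0r !subr0 mulr1.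
Qed.

End BernoulliFun.

(** * Fourier series of Bernoulli polynomials *)

Section Fourier.
Variable R : realType.
Implicit Types (k M m : nat) (x t a b e : R).

Lemma is_derive_cos_affine a b x :
  is_derive x 1 (fun t => cos (a * t + b)) (- (a * sin (a * x + b))).
Proof.
have da : is_derive x 1 (a \*: (@id R) + cst b) a.
  by apply: is_derive_eq; rewrite addr0 [LHS]mulr1.
have := is_derive1_comp (is_derive_cos _) da.
by rewrite mulNr [_ * a]mulrC.
Qed.

Lemma is_derive_sum_fun n (h dh : 'I_n -> R -> R) x :
  (forall i, is_derive x 1 (h i) (dh i x)) ->
  is_derive x 1 (fun t => \sum_i h i t) (\sum_i dh i x).
Proof.
move=> dhi; rewrite (_ : (fun t => _) = \sum_i h i); first exact: is_derive_sum.
by apply/funext => t; rewrite fct_sumE.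
Qed.

Lemma is_derive_scale c (f : R -> R) df x :
  is_derive x 1 f df -> is_derive x 1 (fun t => c * f t) (c * df).
Proof. exact: is_deriveZ. Qed.

(* The shift by [k pi / 2] makes one formula serve the cosine series (even [k])
   and the sine series (odd [k]), with derivative [k] times the previous one. *)
Definition fourier_sum k M x : R :=
  - (2 * k`!%:R / (2 * pi) ^+ k) *
  \sum_(m < M) cos (2 * pi * m.+1%:R * x - k%:R * (pi / 2)) / m.+1%:R ^+ k.

Definition fourier_error k M x := bernoulli_fun k x - fourier_sum k M x.

Lemma is_derive_fourier_sum k M x :
  is_derive x 1 (fourier_sum k.+1 M) (k.+1%:R * fourier_sum k M x).
Proof.
have pi2 : 2 * pi != 0 :> R by rewrite mulf_neq0 ?pnatr_eq0 // gt_eqF ?pi_gt0.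
pose dh (m : 'I_M) t := (m.+1%:R ^+ k.+1)^-1 *
  - (2 * pi * m.+1%:R * sin (2 * pi * m.+1%:R * t - k.+1%:R * (pi / 2))).
have := @is_derive_sum_fun M (fun i t => (i.+1%:R ^+ k.+1)^-1 *
  cos (2 * pi * i.+1%:R * t - k.+1%:R * (pi / 2))) dh x.
move=> /(_ (fun i => is_derive_scale _ (is_derive_cos_affine _ _ _))).
move=> /(is_derive_scale (- (2 * k.+1`!%:R / (2 * pi) ^+ k.+1))) H.
have -> : fourier_sum k.+1 M = (fun t => - (2 * k.+1`!%:R / (2 * pi) ^+ k.+1) *
   \sum_(i < M) ((i.+1%:R ^+ k.+1)^-1 *
     cos (2 * pi * i.+1%:R * t - k.+1%:R * (pi / 2)))).
  by apply/funext => t; congr (_ * _); apply: eq_bigr => i _; rewrite mulrC.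
apply: (is_derive_eq H).
rewrite /fourier_sum !mulr_sumr; apply: eq_bigr => m _.
have -> : cos (2 * pi * m.+1%:R * x - k%:R * (pi / 2)) =
          - sin (2 * pi * m.+1%:R * x - k.+1%:R * (pi / 2)) :> R.
  rewrite -cosDpihalf; congr cos; rewrite -[in RHS]natr1; ring.
rewrite /dh factS natrM !exprS.
have mk : m.+1%:R != 0 :> R by rewrite pnatr_eq0.
have mkk := expf_neq0 k mk; have pk := expf_neq0 k pi2.
have p0 : pi != 0 :> R by rewrite gt_eqF ?pi_gt0.
move: (k.+1%:R : R) (m.+1%:R : R) (pi : R) mk mkk p0 pk => K n p nz nkz pz pkz.
by field; rewrite nz pz nkz pkz.
Qed.

Lemma is_derive_fourier_error k M x :
  is_derive x 1 (fourier_error k.+1 M) (k.+1%:R * fourier_error k M x).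
Proof.
rewrite /fourier_error mulrBr.
exact: (is_deriveB (is_derive_bernoulli_fun k x) (is_derive_fourier_sum k M x)).
Qed.

Lemma continuous_fourier_error k M : continuous (fourier_error k.+1 M).
Proof.
move=> x; apply/differentiable_continuous/derivable1_diffP.
by have [] := is_derive_fourier_error k M x.
Qed.

Lemma cos_addn_2pi n x : cos (x + (2 * pi) * n%:R) = cos x :> R.
Proof.
rewrite -(periodicn (@cosD2pi R) n x); congr (cos (_ + _)).
by rewrite -mulr_natl; ring.
Qed.

Lemma fourier_sum1 k M : fourier_sum k M 1 = fourier_sum k M 0 :> R.
Proof.
congr (_ * _); apply: eq_bigr => m _; congr (_ / _).
by rewrite mulr1 mulr0 addrC cos_addn_2pi add0r.
Qed.

Lemma fourier_error_periodic k M :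
  fourier_error k.+2 M 1 = fourier_error k.+2 M 0.
Proof. by rewrite /fourier_error bernoulli_fun1 fourier_sum1 addr0. Qed.

(** The error of degree [k.+2] takes equal values at 0 and 1, and its derivative is a nonzero
    multiple of the present one: Rolle. *)
Lemma fourier_error_root k M :
  exists2 c : R, c \in `]0, 1[ & fourier_error k.+1 M c = 0.
Proof.
have [|||c c01 dc] := @Rolle R (fourier_error k.+2 M) 0 1 ltr01.
- by move=> x _; have [] := is_derive_fourier_error k.+1 M x.
- exact/continuous_subspaceT/continuous_fourier_error.
- by rewrite fourier_error_periodic.
exists c => //; have := is_derive_fourier_error k.+1 M c => dc'.
have := @derive_val _ _ _ _ _ _ _ dc; rewrite (@derive_val _ _ _ _ _ _ _ dc').
by move=> /eqP; rewrite mulf_eq0 pnatr_eq0 /= => /eqP.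
Qed.

Lemma fourier_error_MVT k M x y : x <= y ->
  exists2 c, c \in `[x, y] & fourier_error k.+1 M y - fourier_error k.+1 M x =
    k.+1%:R * fourier_error k M c * (y - x).
Proof.
move=> xy; apply: (@MVT_segment R (fourier_error k.+1 M)
   (fun t => k.+1%:R * fourier_error k M t)).
- exact: xy.
- by move=> z _; apply: is_derive_fourier_error.
- exact/continuous_subspaceT/continuous_fourier_error.
Qed.

(** A bound on the derivative bounds the oscillation; comparison with a zero makes it a bound on the
    values. *)
Lemma fourier_error_succ k M e :
  (forall x, x \in `[0, 1] -> `|fourier_error k.+1 M x| <= e) ->
  (forall x, x \in `[0, 1] -> `|fourier_error k.+2 M x| <= k.+2%:R * e).
Proof.
move=> He x x01; have [c c01 c0] := fourier_error_root k.+1 M.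
have main u v : u \in `[0, 1] -> v \in `[0, 1] -> u <= v ->
    `|fourier_error k.+2 M v - fourier_error k.+2 M u| <= k.+2%:R * e.
  rewrite !in_itv /= => /andP[u0 u1] /andP[v0 v1] uv.
  have [z + ->] := fourier_error_MVT k.+1 M uv; rewrite in_itv /= => /andP[z0 z1].
  rewrite 2!normrM normr_nat -mulrA ler_wpM2l //.
  rewrite [X in _ * X]ger0_norm ?subr_ge0 // -[leRHS]mulr1 ler_pM ?subr_ge0 //.
    by apply: He; rewrite in_itv /= (le_trans u0 z0) (le_trans z1 v1).
  by rewrite lerBlDr (le_trans v1) ?lerDl.
have c01' : c \in `[0, 1] by move: c01; rewrite !in_itv /= => /andP[/ltW-> /ltW->].
have [xc|/ltW cx] := leP x c.
  by have := main _ _ x01 c01' xc; rewrite c0 sub0r normrN.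
by have := main _ _ c01' x01 cx; rewrite c0 subr0.
Qed.

End Fourier.

(** * The Dirichlet kernel and the error in degree 1 *)

Section Fourier2.
Variable R : realType.
Implicit Types (k M m : nat) (x t a b e : R).

(** In degree 0 the error is [1 + 2 * sum cos (2 pi m t)], which telescopes when multiplied by
    [sin (pi t)]. *)
Lemma dirichlet_kernel M t :
  fourier_error 0 M t * sin (pi * t) = sin ((2 * M + 1)%:R * (pi * t)) :> R.
Proof.
rewrite /fourier_error bernoulli_fun0 /fourier_sum.
elim: M => [|M IH]; first by rewrite big_ord0 mulr0 subr0 !mul1r.
rewrite big_ord_recr /= mulrDr opprD addrA mulrDl IH.
rewrite fact0 !expr0 !divr1 !mulr1 mul0r subr0.
have -> : (2 * M + 1)%:R * (pi * t) = 2 * pi * M.+1%:R * t - pi * t :> R.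
  by rewrite -[M.+1%:R]natr1 natrD natrM; ring.
have -> : (2 * M.+1 + 1)%:R * (pi * t) = 2 * pi * M.+1%:R * t + pi * t :> R.
  by rewrite -[M.+1%:R]natr1 natrD natrM -[M.+1%:R]natr1; ring.
rewrite sinB sinD; ring.
Qed.

(* The second term cancels the oscillating part of the derivative, which becomes
   O(1/M) away from the integers. *)
Let G M t : R := fourier_error 1 M t +
  ((2 * M + 1)%:R * pi)^-1 * (cos ((2 * M + 1)%:R * pi * t + 0) * (cos (pi * t - pi / 2))^-1).

Let is_derive_G M t : 0 < sin (pi * t) ->
  is_derive t 1 (G M)
    (- (cos ((2 * M + 1)%:R * pi * t) * cos (pi * t)) / ((2 * M + 1)%:R * sin (pi * t) ^+ 2)).
Proof.
move=> st; set L : R := (2 * M + 1)%:R.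
have s0 : cos (pi * t - pi / 2) != 0 by rewrite cosBpihalf gt_eqF.
have d1 := is_derive_cos_affine (L * pi) 0 t.
have d2 := is_derive_cos_affine pi (- (pi / 2)) t.
have d3 := is_deriveV s0 d2.
have d4 := is_derive_scale (L * pi)^-1 (is_deriveM d1 d3).
have d5 := is_deriveD (is_derive_fourier_error 0 M t) d4.
apply: (is_derive_eq d5).
rewrite /= addr0 mul1r cosBpihalf sinBpihalf.
have -> : fourier_error 0 M t = sin (L * pi * t) / sin (pi * t).
  by rewrite -mulrA -dirichlet_kernel mulfK ?gt_eqF.
rewrite /GRing.scale /=.
have L0 : L != 0 by rewrite /L pnatr_eq0 addn1.
have p0 : pi != 0 :> R by rewrite gt_eqF ?pi_gt0.
move: st => /lt0r_neq0; clearbody L; move: L0 p0; clear.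
move: (sin (pi * t)) (cos (pi * t)) (sin (L * pi * t)) (cos (L * pi * t)).
move: (pi : R) => p s c s' c' L0 p0 s0.
by field; rewrite L0 p0 s0.
Qed.

(** The base point for the mean value estimate: [B_1] vanishes at 1/2, and all cosines are taken at
    odd multiples of [pi / 2]. *)
Let G_half M : G M (1 / 2) = 0.
Proof.
rewrite /G /fourier_error bernoulli_fun1E subrr sub0r addr0.
have -> : (2 * M + 1)%:R * pi * (1 / 2) = pi / 2 + pi *+ M :> R.
  by rewrite natrD natrM -mulr_natl; field.
have cosn n : cos (pi / 2 + pi *+ n) = 0 :> R.
  by rewrite (alternatingn (@cosDpi R)) cos_pihalf mulr0.
rewrite cosn mul0r mulr0 addr0 /fourier_sum big1 ?mulr0 ?oppr0 // => i _.
have -> : 2 * pi * i.+1%:R * (1 / 2) - 1%:R * (pi / 2) = pi / 2 + pi *+ i :> R.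
  by rewrite -natr1 -mulr_natl; field.
by rewrite cosn mul0r.
Qed.

Lemma sin_ge_near_half a t : 0 < a -> a <= t -> t <= 1 - a ->
  sin (pi * a) <= sin (pi * t) :> R.
Proof.
move=> a0 at_ ta; have p0 := pi_gt0 R.
have mono u : a <= u -> u <= 1 / 2 -> sin (pi * a) <= sin (pi * u).
  move=> au u2; rewrite -(cosBpihalf (pi * a)) -(cosBpihalf (pi * u)).
  rewrite -(cosN (pi * a - _)) -(cosN (pi * u - _)).
  rewrite leNgt; apply/negP; rewrite ltr_cos ?in_itv /=; nra.
have [t2|t2] := leP t (1 / 2); first exact: mono.
have -> : sin (pi * t) = sin (pi * (1 - t)).
  have -> : pi * (1 - t) = - (pi * t) + pi by ring.
  by rewrite (@sinDpi R) sinN opprK.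
by apply: mono; lra.
Qed.

Lemma fourier_error1_bound a : 0 < a -> a < 1 / 2 ->
  exists2 C, 0 < C & forall M x, a <= x -> x <= 1 - a ->
    `|fourier_error 1 M x| <= C / (2 * M + 1)%:R.
Proof.
move=> a0 a2; set s := sin (pi * a : R).
have p0 := pi_gt0 R; have p2 := pi_ge2 R.
have s0 : 0 < s by rewrite sin_gt0_pi //; nra.
(* Up to the factor [2 M + 1], the first summand bounds the derivative of [G] on [[a, 1 - a]] and
   the second bounds the correction term of [G]. *)
exists (s ^- 2 + (pi * s)^-1) => [|M x ax xa].
  by rewrite addr_gt0 ?invr_gt0 ?exprn_gt0 ?mulr_gt0.
set L : R := (2 * M + 1)%:R; have L0 : 0 < L by rewrite /L ltr0n addn1.
have sx t : a <= t -> t <= 1 - a -> s <= sin (pi * t) by exact: sin_ge_near_half.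
have sx0 t : a <= t -> t <= 1 - a -> 0 < sin (pi * t).
  by move=> ? ?; rewrite (lt_le_trans s0) ?sx.
pose dG t := - (cos (L * pi * t) * cos (pi * t)) / (L * sin (pi * t) ^+ 2).
have bG u v : a <= u -> v <= 1 - a -> u <= v -> `|G M v - G M u| <= s ^- 2 / L.
  move=> au va uv.
  have inuv t : t \in `[u, v] -> a <= t /\ t <= 1 - a.
    by rewrite in_itv /= => /andP[? ?]; lra.
  have [||c cuv ->] := @MVT_segment R (G M) dG u v uv.
  - move=> t tuv; apply: is_derive_G; apply: sx0; move: tuv; rewrite in_itv /=; lra.
  - apply: derivable_within_continuous => t /inuv[? ?].
    by have [] := is_derive_G M (sx0 t _ _).
  have [ac ca] := inuv _ cuv.
  rewrite normrM [X in _ * X]ger0_norm ?subr_ge0 //.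
  apply: (@le_trans _ _ (s ^- 2 / L * 1)); last by rewrite mulr1.
  apply: ler_pM; rewrite ?subr_ge0 //; last lra.
  rewrite normrM normrN normrM normfV -[leRHS]mul1r ler_pM ?mulr_ge0 //.
    by rewrite -[1]mulr1 ler_pM ?cos_max.
  have sc := sx c ac ca; have sc0 := sx0 c ac ca.
  rewrite gtr0_norm ?mulr_gt0 ?exprn_gt0 // invfM mulrC ler_wpM2r ?invr_ge0 ?(ltW L0) //.
  by rewrite lef_pV2 ?posrE ?exprn_gt0 // ler_pXn2r // nnegrE ltW.
have bG' : `|G M x| <= s ^- 2 / L.
  have [x2|/ltW x2] := leP x (1 / 2).
    have := @bG x (1/2) ax; rewrite G_half sub0r normrN; apply => //; lra.
  have := @bG (1/2) x; rewrite G_half subr0; apply => //; lra.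
have -> : fourier_error 1 M x =
    G M x - (L * pi)^-1 * (cos (L * pi * x + 0) * (cos (pi * x - pi / 2))^-1).
  by rewrite /G addrK.
rewrite [X in _ <= X]mulrDl; apply: (le_trans (ler_normB _ _)). apply: lerD => //.
have sc := sx x ax xa; have sx_gt0 := sx0 x ax xa.
rewrite cosBpihalf !normrM !normfV normrM (gtr0_norm L0) (gtr0_norm p0) (gtr0_norm sx_gt0).
apply: (@le_trans _ _ ((L * pi)^-1 * (1 * s^-1))).
  rewrite ler_wpM2l ?invr_ge0 ?mulr_ge0 ?(ltW L0) ?(ltW p0) //.
  by rewrite ler_pM ?invr_ge0 ?cos_max ?(ltW sx_gt0) ?lef_pV2 ?posrE.
by rewrite mul1r -!invfM [L * pi]mulrC mulrAC.
Qed.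

End Fourier2.

(** * The uniform error bound from degree 2 on *)

Section Fourier3.
Variable R : realType.
Implicit Types (k M N m : nat) (x t a b e : R).

(** Telescoping, as [n^-2 <= 2 / n - 2 / (n + 1)], which amounts to [1 <= 2 n / (n + 1)]. *)
Lemma sum_inv_sqr_le M N : (M <= N)%N ->
  \sum_(M <= m < N) m.+1%:R ^- 2 <= 2 / M.+1%:R - 2 / N.+1%:R :> R.
Proof.
elim: N => [|N IH]; first by rewrite leqn0 => /eqP->; rewrite big_geq // subrr.
rewrite leq_eqVlt => /predU1P[->|]; first by rewrite big_geq // subrr.
rewrite ltnS => MN; rewrite big_nat_recr //=.
have N1 : 0 < N.+1%:R :> R by [].
suff H : N.+1%:R ^- 2 <= 2 / N.+1%:R - 2 / N.+2%:R :> R.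
  by rewrite (le_trans (lerD (IH MN) H)) // addrA subrK.
have n1 : 1 <= N.+1%:R :> R by rewrite ler1n.
rewrite -[N.+2%:R]natr1; move: (N.+1%:R : R) N1 n1 => n n0 n1.
have -> : 2 / n - 2 / (n + 1) = n ^- 2 * (2 * n / (n + 1)).
  by field; rewrite !gt_eqF //; lra.
rewrite -[leLHS]mulr1 ler_wpM2l ?invr_ge0 ?exprn_ge0 ?(ltW n0) //.
rewrite ler_pdivlMr; lra.
Qed.

Let c2 : R := 2 * 2`!%:R / (2 * pi) ^+ 2.

Let c2_ge0 : 0 <= c2.
Proof. by rewrite divr_ge0 ?mulr_ge0 ?exprn_ge0 ?mulr_ge0 ?pi_ge0. Qed.

(** The polynomial cancels, and what remains is a tail of inverse squares. *)
Let fourier_error2_dist M N x : (M <= N)%N ->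
  `|fourier_error 2 N x - fourier_error 2 M x| <= 2 * c2 / M.+1%:R.
Proof.
move=> MN; have -> : fourier_error 2 N x - fourier_error 2 M x =
    fourier_sum 2 M x - fourier_sum 2 N x by rewrite /fourier_error; ring.
rewrite /fourier_sum -/c2 -mulrBr normrM normrN (ger0_norm c2_ge0) [leRHS]mulrAC [leRHS]mulrC.
rewrite ler_wpM2l // -!(big_mkord xpredT (fun m =>
  cos (2 * pi * m.+1%:R * x - 2 * (pi / 2)) / m.+1%:R ^+ 2)).
rewrite [X in _ - X](@big_cat_nat _ _ _ M) //= opprD addrA subrr add0r normrN.
apply: (le_trans (ler_norm_sum _ _ _)).
apply: (@le_trans _ _ (\sum_(M <= m < N) m.+1%:R ^- 2)); last first.
  apply: (le_trans (sum_inv_sqr_le MN)).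
  by rewrite lerBlDr lerDl divr_ge0.
apply: ler_sum => i _; rewrite normrM normfV normrX normr_nat.
by rewrite -[leRHS]mul1r ler_wpM2r ?invr_ge0 ?exprn_ge0 ?cos_max.
Qed.

(* Up to a tail of the series, the oscillation is that of a much longer partial
   sum, whose derivative is small on [[x, y]]. *)
Let fourier_error2_osc M x y : 0 < x -> x <= y -> y < 1 ->
  `|fourier_error 2 M y - fourier_error 2 M x| <= 4 * c2 / M.+1%:R.
Proof.
move=> x0 xy y1; apply/ler_addgt0Pr => e e0.
(* A margin that keeps [[x, y]] inside [[a, 1 - a]]; the entry 1/3 ensures [a < 1 / 2]. *)
pose a := Num.min (x / 2) (Num.min ((1 - y) / 2) (1 / 3)).
have a0 : 0 < a by rewrite /a !lt_min; apply/and3P; split; lra.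
have a2 : a < 1 / 2 by rewrite /a !gt_min; apply/orP; right; apply/orP; right; lra.
have ax : a <= x by rewrite /a ge_min; apply/orP; left; lra.
have ay : y <= 1 - a.
  suff : a <= 1 - y by lra.
  by rewrite /a !ge_min; apply/orP; right; apply/orP; left; lra.
have [C C0 HC] := fourier_error1_bound a0 a2.
(* Chosen so that [2 C / (2 N + 1) <= e]; the factor 2 comes from the derivative, twice the error of
   degree 1. *)
pose N := (maxn M (Num.truncn (2 * C / e)).+1).
have MN : (M <= N)%N by rewrite leq_maxl.
have Ne : 2 * C / (2 * N + 1)%:R <= e.
  have N1 : 2 * C / e < N%:R.
    apply: (lt_le_trans (truncnS_gt _)); by rewrite ler_nat leq_maxr.
  rewrite ler_pdivrMr ?ltr0n ?addn1 // [leRHS]mulrC -ler_pdivrMr // (le_trans (ltW N1)) //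
    ler_nat.
  by rewrite -[leqLHS]mul1n (leq_trans _ (leqnSn _)) // leq_mul2r orbT.
have osc : `|fourier_error 2 N y - fourier_error 2 N x| <= e.
  have [c cxy ->] := fourier_error_MVT 1 N xy.
  move: cxy; rewrite in_itv /= => /andP[xc cy].
  rewrite !normrM normr_nat [X in _ * X]ger0_norm ?subr_ge0 //.
  apply: le_trans Ne; rewrite -[leLHS]mulrA -[leRHS]mulrA ler_wpM2l // -[leRHS]mulr1.
  apply: ler_pM; rewrite ?subr_ge0 //; last lra.
  by apply: HC; lra.
have dy := fourier_error2_dist y MN; have dx := fourier_error2_dist x MN.
have -> : fourier_error 2 M y - fourier_error 2 M x =
  (fourier_error 2 N y - fourier_error 2 N x) -
  (fourier_error 2 N y - fourier_error 2 M y) +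
  (fourier_error 2 N x - fourier_error 2 M x) by ring.
apply: (le_trans (ler_normD _ _)); apply: (@le_trans _ _ (e + 2 * c2 / M.+1%:R + 2 * c2 /
  M.+1%:R)).
  by rewrite lerD // (le_trans (ler_normB _ _)) // lerD.
by rewrite -addrA -mulrDl -mulrDl addrC lerD2r (_ : 2 + 2 = 4) //; ring.
Qed.

(** Inside the interval the oscillation is compared with a zero of the error. The oscillation
    estimate does not reach the endpoints: 0 is obtained as a limit from the right, and 1 by
    periodicity. *)
Lemma fourier_error2_bound : exists2 C, 0 <= C &
  forall M x, x \in `[0, 1]%R -> `|fourier_error 2 M x| <= C / M.+1%:R.
Proof.
exists (4 * c2) => [|M]; first by rewrite mulr_ge0.
have inner x : 0 < x -> x < 1 -> `|fourier_error 2 M x| <= 4 * c2 / M.+1%:R.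
  move=> x0 x1; have [c] := fourier_error_root R 1 M; rewrite in_itv /= => /andP[c0 c1] Ec.
  have [xc|/ltW cx] := leP x c.
    by have := fourier_error2_osc M x0 xc c1; rewrite Ec sub0r normrN.
  by have := fourier_error2_osc M c0 cx x1; rewrite Ec subr0.
have at0 : `|fourier_error 2 M 0| <= 4 * c2 / M.+1%:R.
  apply/ler_addgt0Pr => e e0.
  have : \forall y \near 0^'+, `|fourier_error 2 M 0 - fourier_error 2 M y| < e.
    have /cvg_at_right_filter/cvgrPdist_lt := @continuous_fourier_error R 1 M 0; exact.
  move=> H; have [y [yd [y0 y1]]] := @filter_ex _ (0 : R)^'+ _ _ (filterI H
    (filterI (nbhs_right_gt 0) (nbhs_right_lt (@ltr01 R)))).
  rewrite -(subrK (fourier_error 2 M y) (fourier_error 2 M 0)).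
  by rewrite (le_trans (ler_normD _ _)) // addrC lerD ?inner // ltW.
move=> x; rewrite in_itv /= => /andP[].
rewrite le_eqVlt => /predU1P[<-//|x0]; rewrite le_eqVlt => /predU1P[->|x1]; last exact: inner.
by rewrite fourier_error_periodic.
Qed.

Lemma fourier_error_bound k : exists2 C, 0 <= C &
  forall M x, x \in `[0, 1]%R -> `|fourier_error k.+2 M x| <= C / M.+1%:R.
Proof.
elim: k => [|k [C C0 HC]]; first exact: fourier_error2_bound.
exists (k.+3%:R * C) => [|M x x01]; first by rewrite mulr_ge0.
by rewrite -mulrA; apply: (fourier_error_succ (HC M)).
Qed.

(** In even degree the phase is a multiple of [pi] and turns into the sign [(-1) ^+ k]. *)
Lemma fourier_sum_even k M x : fourier_sum (2 * k) M x =
  - ((-1) ^+ k * (2 * k)`!%:R / (2 * pi) ^+ (2 * k)) *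
  (2 * \sum_(m < M) cos (2 * pi * m.+1%:R * x) / m.+1%:R ^+ (2 * k)) :> R.
Proof.
rewrite /fourier_sum.
rewrite (eq_bigr (fun m : 'I_M => (-1) ^+ k *
    (cos (2 * pi * m.+1%:R * x) / m.+1%:R ^+ (2 * k)))) => [|m _]; last first.
  rewrite [RHS]mulrA; congr (_ / _).
  rewrite -cosN opprB addrC -[in RHS]cosN -(alternatingn (@cosDpi R)).
  by congr cos; rewrite natrM -[pi *+ k]mulr_natl; field.
rewrite -mulr_sumr; set S := \sum_(_ < _) _; ring.
Qed.

End Fourier3.

(** * Iterated integrals *)

Local Notation integrable01 f :=
  (lebesgue_measure.-integrable (`[0, 1]%classic : set _) (EFin \o f)).

Section UnitIntegral.
Variable R : realType.
Local Notation mu := (@lebesgue_measure R).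

Lemma continuous_integrable01 (f : R -> R) : continuous f -> integrable01 f.
Proof.
move=> cf; apply: continuous_compact_integrable; first exact: segment_compact.
exact: continuous_subspaceT.
Qed.

Lemma integrable01Z c (f : R -> R) : integrable01 f -> integrable01 (fun t => c * f t).
Proof.
move=> Hf; by have := integrableZl _ c Hf; apply; exact: measurable_itv.
Qed.

Lemma integrable01D (f g : R -> R) :
  integrable01 f -> integrable01 g -> integrable01 (fun t => f t + g t).
Proof.
by move=> Hf Hg; have := integrableD _ Hf Hg; apply; exact: measurable_itv.
Qed.

Lemma integrable01_sum (I : Type) (r : seq I) (f : I -> R -> R) :
  (forall i, integrable01 (f i)) -> integrable01 (fun t => \sum_(i <- r) f i t).
Proof.
move=> Hf; elim: r => [|i r IH].
  under [X in EFin \o X]eq_fun do rewrite big_nil.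
  exact/continuous_integrable01/cst_continuous.
under [X in EFin \o X]eq_fun do rewrite big_cons.
exact: integrable01D.
Qed.

Lemma Rintegral01_sum (I : Type) (r : seq I) (f : I -> R -> R) :
  (forall i, integrable01 (f i)) ->
  \int[mu]_(t in `[0, 1]) (\sum_(i <- r) f i t) = \sum_(i <- r) \int[mu]_(t in `[0, 1]) f i t.
Proof.
move=> Hf; elim: r => [|i r IH].
  under eq_Rintegral do rewrite big_nil.
  by rewrite big_nil Rintegral_cst // mul0r.
under eq_Rintegral do rewrite big_cons.
by rewrite big_cons RintegralD ?IH //; exact: integrable01_sum.
Qed.

Lemma Rintegral01_cst (c : R) : \int[mu]_(t in `[0, 1]) c = c.
Proof.
have mu01 : fine (mu `[(0 : R), 1]%classic) = 1.
  by rewrite lebesgue_measure_itv /= lte_fin ltr01 oppr0 adde0.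
by rewrite Rintegral_cst //; apply: etrans (mulr1 c); congr (c * _); exact: mu01.
Qed.

Lemma norm_Rintegral01_le (f : R -> R) e : integrable01 f ->
  (forall t, 0 <= t <= 1 -> `|f t| <= e) -> `|\int[mu]_(t in `[0, 1]) f t| <= e.
Proof.
move=> If Hf; rewrite (le_trans (le_normr_Rintegral _ If)) //.
rewrite -[leRHS]Rintegral01_cst; apply: le_Rintegral => //.
- have := integrable_norm If; apply: eq_integrable => // x _.
- exact/continuous_integrable01/cst_continuous.
Qed.

Lemma Rintegral01_FTC (f F : R -> R) : continuous f ->
  (forall x : R, is_derive x 1 F (f x)) ->
  \int[mu]_(t in `[0, 1]) f t = F 1 - F 0.
Proof.
move=> cf dF; have cF : continuous F.
  by move=> x; apply/differentiable_continuous/derivable1_diffP; have [] := dF x.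
rewrite /Rintegral (@continuous_FTC2 _ f F) //.
- exact: continuous_subspaceT.
- split => [x _||]; first by have [] := dF x.
  + exact/cvg_at_right_filter/cF.
  + exact/cvg_at_left_filter/cF.
- by move=> x _; rewrite derive1E; apply: derive_val.
Qed.

End UnitIntegral.

Section IteratedIntegral.
Variables (R : realType) (V : vectType R).
Implicit Types (s : seq V) (F G : (V -> R) -> R) (x : V -> R) (t e c : R).

Definition upd (a : V) t x : V -> R := fun b => if b == a then t else x b.

(** What linearity demands at each level: every inner integral is integrable in the next coordinate,
    whatever values the outer coordinates have. *)
Fixpoint iint_ok s F : Prop :=
  if s is a :: s' then
    (forall t, iint_ok s' (F \o upd a t)) /\
    integrable01 (fun t => iterated_integral s' (F \o upd a t))
  else True.

Lemma iterated_integral_cons a s F : iterated_integral (a :: s) F =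
  \int[lebesgue_measure]_(t in `[0, 1]) iterated_integral s (F \o upd a t).
Proof. by []. Qed.

Lemma iterated_integralD s F G : iint_ok s F -> iint_ok s G ->
  iint_ok s (fun x => F x + G x) /\
  iterated_integral s (fun x => F x + G x) = iterated_integral s F + iterated_integral s G.
Proof.
elim: s F G => [//|a s IH] F G [okF IF] [okG IG].
have E t := IH _ _ (okF t) (okG t).
have EF : (fun t => iterated_integral s ((fun x => F x + G x) \o upd a t)) =
   (fun t => iterated_integral s (F \o upd a t) + iterated_integral s (G \o upd a t)).
  by apply/funext => t; have [_ ->] := E t.
split; first split=> [t|]; first by have [] := E t.
  by rewrite EF; exact: integrable01D.
by rewrite !iterated_integral_cons EF RintegralD //; exact: measurable_itv.
Qed.

Lemma iterated_integralZ s c F : iint_ok s F ->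
  iint_ok s (fun x => c * F x) /\
  iterated_integral s (fun x => c * F x) = c * iterated_integral s F.
Proof.
elim: s F => [//|a s IH] F [okF IF].
have E t := IH _ (okF t).
have EF : (fun t => iterated_integral s ((fun x => c * F x) \o upd a t)) =
   (fun t => c * iterated_integral s (F \o upd a t)).
  by apply/funext => t; have [_ ->] := E t.
split; first split=> [t|]; first by have [] := E t.
  by rewrite EF; exact: integrable01Z.
by rewrite !iterated_integral_cons EF RintegralZl //; exact: measurable_itv.
Qed.

Lemma iterated_integral0 s : iint_ok s (fun=> 0) /\ iterated_integral s (fun=> 0 : R) = 0.
Proof.
elim: s => [//|a s [ok0 I0]].
split; first split=> [//|]; last by rewrite iterated_integral_cons /comp I0 Rintegral01_cst.
by rewrite [X in EFin \o X](_ : _ = cst 0) ?funeqE //;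
  exact/continuous_integrable01/cst_continuous.
Qed.

Lemma iterated_integral_sum s (I : Type) (r : seq I) (F : I -> (V -> R) -> R) :
  (forall i, iint_ok s (F i)) ->
  iint_ok s (fun x => \sum_(i <- r) F i x) /\
  iterated_integral s (fun x => \sum_(i <- r) F i x) = \sum_(i <- r) iterated_integral s (F i).
Proof.
move=> okF; elim: r => [|i r [okr Ir]].
  have -> : (fun x => \sum_(i <- [::]) F i x) = (fun=> 0) by apply/funext=> x; rewrite big_nil.
  by rewrite big_nil; exact: iterated_integral0.
have -> : (fun x => \sum_(i <- i :: r) F i x) = (fun x => F i x + \sum_(i <- r) F i x).
  by apply/funext=> x; rewrite big_cons.
by have [] := iterated_integralD (okF i) okr; rewrite Ir big_cons.
Qed.

Definition unit_cube x := forall b, 0 <= x b <= 1.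

Lemma unit_cube_upd a t x : 0 <= t <= 1 -> unit_cube x -> unit_cube (upd a t x).
Proof. by move=> t01 x01 b; rewrite /upd; case: eqP. Qed.

Lemma norm_iterated_integral_le s F e : iint_ok s F ->
  (forall x, unit_cube x -> `|F x| <= e) -> `|iterated_integral s F| <= e.
Proof.
elim: s F => [|a s IH] F; first by move=> _; apply=> b; rewrite lexx ler01.
move=> [okF IF] HF; rewrite iterated_integral_cons norm_Rintegral01_le //.
by move=> t t01; apply: IH (okF t) _ => x x01; apply/HF/unit_cube_upd.
Qed.

Lemma eq_iterated_integral s F G : (forall x, unit_cube x -> F x = G x) ->
  iterated_integral s F = iterated_integral s G.
Proof.
elim: s F G => [|a s IH] F G FG; first by apply: FG => b; rewrite lexx ler01.
rewrite !iterated_integral_cons; apply: eq_Rintegral => t; rewrite inE /= in_itv /= => t01.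
by apply: IH => x x01; apply/FG/unit_cube_upd.
Qed.

Lemma iterated_integral_dist_le s F G e : iint_ok s F -> iint_ok s G ->
  (forall x, unit_cube x -> `|F x - G x| <= e) ->
  `|iterated_integral s F - iterated_integral s G| <= e.
Proof.
move=> okF okG FG; have [okG' IG] := iterated_integralZ (-1) okG.
have [okFG IFG] := iterated_integralD okF okG'.
rewrite -[X in `|_ + X|]mulN1r -IG -IFG; apply: norm_iterated_integral_le => // x x01.
by rewrite mulN1r; exact: FG.
Qed.

(** The phase [th] absorbs the outer coordinates, which are fixed during the inner integrations;
    this is what the induction needs. The hypothesis for every phase [y] makes each coordinate
    contribute only a scalar factor, with no sine component. *)
Lemma iterated_integral_fourier s (T : V -> R -> R) (g : V -> int -> R) (c : V -> int) (th : R) :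
  uniq s ->
  (forall a (n : int) (y : R), integrable01 (fun t => T a t * cos (y + 2 * pi * n%:~R * t))) ->
  (forall a (n : int) (y : R), \int[lebesgue_measure]_(t in `[0, 1])
     (T a t * cos (y + 2 * pi * n%:~R * t)) = g a n * cos y) ->
  let F x := (\prod_(a <- s) T a (x a)) * cos (th + 2 * pi * \sum_(a <- s) (c a)%:~R * x a) in
  iint_ok s F /\ iterated_integral s F = (\prod_(a <- s) g a (c a)) * cos th.
Proof.
move=> /= us iT IT; elim: s th us => [|a s IH] th.
  by rewrite /= !big_nil mulr0 addr0.
move=> /= /andP[as_ us].
set F := fun x => _.
have Fupd t : F \o upd a t = fun x => T a t * (\prod_(b <- s) T b (x b) *
   cos ((th + 2 * pi * (c a)%:~R * t) + 2 * pi * \sum_(b <- s) (c b)%:~R * x b)).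
  apply/funext => x; rewrite /F /= !big_cons /upd eqxx mulrA.
  have nb b : b \in s -> b == a = false by move=> bs; apply: contraNF as_ => /eqP <-.
  congr (_ * _ * cos _).
    by apply: eq_big_seq => b bs; rewrite nb.
  rewrite mulrDr -addrA mulrA; congr (_ + (_ + _ * _)).
  by apply: eq_big_seq => b bs; rewrite nb.
have H t := IH (th + 2 * pi * (c a)%:~R * t) us.
have H' t := iterated_integralZ (T a t) (H t).1.
have E : (fun t => iterated_integral s (F \o upd a t)) =
    (fun t => (\prod_(b <- s) g b (c b)) * (T a t * cos (th + 2 * pi * (c a)%:~R * t))).
  by apply/funext => t; rewrite Fupd (H' t).2 (H t).2 mulrCA.
split; first split=> [t|].
- by rewrite Fupd; exact: (H' t).1.
- by rewrite E; exact/integrable01Z/iT.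
rewrite E.
have -> := RintegralZl _ _ (iT a (c a) th); last exact: measurable_itv.
by rewrite IT big_cons mulrCA mulrA.
Qed.

End IteratedIntegral.

(** * Symmetric cosine sums *)

(** Encodes the integers from [- M] to [M] by a finite type, so that tuples of them are finite
    functions. *)
Definition sym_idx M (j : 'I_(2 * M).+1) : int := j%:Z - M%:Z.

Lemma sym_sum (R : zmodType) M (h : int -> R) :
  \sum_(j < (2 * M).+1) h (sym_idx j) = h 0 + \sum_(m < M) (h m.+1%:Z + h (- m.+1%:Z)).
Proof.
rewrite /sym_idx; elim: M => [|M IH].
  by rewrite big_ord_recl !big_ord0 /= subrr.
rewrite -(big_mkord xpredT (fun j => h (j%:Z - M.+1%:Z))) mulnS.
rewrite big_nat_recl // big_nat_recr //= !big_mkord [in RHS]big_ord_recr /=.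
rewrite (eq_bigr (fun j : 'I_(2 * M).+1 => h (j%:Z - M%:Z))) => [|j _]; last first.
  by congr h; lia.
rewrite IH sub0r [LHS]addrC -!(addrA (h 0)) -addrA; congr (_ + (_ + (h _ + _))); lia.
Qed.

Section CosSum.
Variable R : realType.
Implicit Types (k M : nat) (n : int) (x y t e : R).

(* The term of index 0 vanishes for [0 < k], as [0^-1 = 0]. *)
Definition cos_sum k M y : R := \sum_(j < (2 * M).+1)
  (sym_idx j)%:~R ^- (2 * k) * cos (2 * pi * (sym_idx j)%:~R * y).

Definition cos_coef k M n : R := if (`|n| <= M)%N then n%:~R ^- (2 * k) else 0.

Lemma evenN_expV k n : (- n)%:~R ^- (2 * k) = n%:~R ^- (2 * k) :> R.
Proof. by rewrite mulrNz exprM sqrrN -exprM. Qed.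

Lemma exp0V k : (0 < k)%N -> (0 : int)%:~R ^- (2 * k) = 0 :> R.
Proof. by move=> k0; rewrite expr0n muln_eq0 /= -leqn0 leqNgt k0 /= invr0. Qed.

Lemma cos_sumE k M y : (0 < k)%N ->
  cos_sum k M y = 2 * \sum_(m < M) cos (2 * pi * m.+1%:R * y) / m.+1%:R ^+ (2 * k).
Proof.
move=> k0; rewrite /cos_sum (sym_sum _ (fun n => n%:~R ^- (2 * k) * cos (2 * pi * n%:~R * y))).
rewrite exp0V // mul0r add0r mulr_sumr; apply: eq_bigr => m _.
rewrite evenN_expV mulrNz mulrN mulNr cosN /= [(_ / _)]mulrC; ring.
Qed.

Lemma sin_addz_2pi n x : sin (x + 2 * pi * n%:~R) = sin x :> R.
Proof.
have H (m : nat) z : sin (z + 2 * pi * m%:R) = sin z :> R.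
  rewrite -(periodicn (@sinD2pi R) m z); congr (sin (_ + _)).
  by rewrite -mulr_natl; ring.
case: n => m; first exact: H.
by rewrite NegzE mulrNz mulrN -[LHS](H m.+1) subrK.
Qed.

Lemma cos_addz_2pi n x : cos (x + 2 * pi * n%:~R) = cos x :> R.
Proof. by rewrite -!sinDpihalf addrAC sin_addz_2pi. Qed.

Lemma cos_sum_frac k M y : cos_sum k M (frac_part y) = cos_sum k M y.
Proof.
apply: eq_bigr => j _; congr (_ * _); rewrite -[in RHS](subrK (Num.floor y)%:~R y) [in RHS]mulrDr.
by rewrite -[_ * (Num.floor y)%:~R]mulrA -intrM cos_addz_2pi.
Qed.

Lemma continuous_cos_affine y n : continuous (fun t => cos (y + 2 * pi * n%:~R * t)).
Proof.
move=> t; apply/differentiable_continuous/derivable1_diffP.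
have [+ _] := is_derive_cos_affine (2 * pi * n%:~R) y t.
by rewrite (_ : (fun t => _) = (fun t => cos (y + 2 * pi * n%:~R * t))) //; apply/funext =>
  z; rewrite addrC.
Qed.

Lemma Rintegral01_cos y n :
  \int[lebesgue_measure]_(t in `[0, 1]) (cos (y + 2 * pi * n%:~R * t)) = (n == 0)%:R * cos y.
Proof.
case: eqP => [->|/eqP n0].
  rewrite mul1r -[RHS]Rintegral01_cst; apply: eq_Rintegral => t _.
  by rewrite mulr0 mul0r addr0.
have c0 : 2 * pi * n%:~R != 0 :> R.
  by rewrite !mulf_neq0 ?intr_eq0 // ?pnatr_eq0 // gt_eqF ?pi_gt0.
pose F t : R := (2 * pi * n%:~R)^-1 * cos ((2 * pi * n%:~R) * t + (y - pi / 2)).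
have dF t : is_derive t 1 F (cos (y + 2 * pi * n%:~R * t)).
  apply: (is_derive_eq (is_derive_scale _ (is_derive_cos_affine _ _ _))).
  by rewrite mulrN mulKf // addrA sinBpihalf opprK addrC.
rewrite (Rintegral01_FTC (@continuous_cos_affine y n) dF) /F.
by rewrite mulr1 mulr0 add0r addrA !cosBpihalf [_ + y]addrC sin_addz_2pi subrr mul0r.
Qed.

Lemma sum_sym_idx M n (f : int -> R) :
  \sum_(j < (2 * M).+1) (sym_idx j == n)%:R * f (sym_idx j) = if (`|n| <= M)%N then f n else 0.
Proof.
case: ifP => nM; last first.
  rewrite big1 // => j _; case: eqP => [E|]; last by rewrite mul0r.
  by move: nM; rewrite -E /sym_idx; have := ltn_ord j; lia.
have nj : (absz (n + M%:Z)%R < (2 * M).+1)%N by lia.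
rewrite (bigD1 (Ordinal nj)) //= big1 => [|j].
  rewrite addr0 (_ : sym_idx _ = n) ?eqxx ?mul1r //; rewrite /sym_idx /=; lia.
move=> /eqP jn; case: eqP => [E|]; last by rewrite mul0r.
by case: jn; apply: val_inj; move: E; rewrite /sym_idx /=; lia.
Qed.

Lemma cos_sum_fourier k M n y :
  integrable01 (fun t => cos_sum k M t * cos (y + 2 * pi * n%:~R * t)) /\
  \int[lebesgue_measure]_(t in `[0, 1]) (cos_sum k M t * cos (y + 2 * pi * n%:~R * t))
   = cos_coef k M n * cos y.
Proof.
(* Product to sum: frequency 0 occurs for [j = - n] and for [j = n], each with half of the
   coefficient, and the two halves agree because the exponent is even. *)
pose h (j : 'I_(2 * M).+1) t : R := ((sym_idx j)%:~R ^- (2 * k) / 2) *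
    (cos (y + 2 * pi * (n + sym_idx j)%:~R * t) + cos (y + 2 * pi * (n - sym_idx j)%:~R * t)).
have E : (fun t => cos_sum k M t * cos (y + 2 * pi * n%:~R * t)) = (fun t => \sum_j h j t).
  apply/funext => t; rewrite /cos_sum mulr_suml; apply: eq_bigr => j _.
  rewrite /h; set u := 2 * pi * n%:~R * t; set v := 2 * pi * (sym_idx j)%:~R * t.
  have -> : y + 2 * pi * (n + sym_idx j)%:~R * t = (y + u) + v by rewrite /u /v intrD; ring.
  have -> : y + 2 * pi * (n - sym_idx j)%:~R * t = (y + u) - v by rewrite /u /v intrB; ring.
  set w := y + u; rewrite [cos (w - v)]cosB [cos (w + v)]cosD.
  by move: (_ ^- _) (cos v) (cos w) (sin w) (sin v) => a b c d e; field.
have Ih a b : integrable01 (fun t => cos (y + 2 * pi * a%:~R * t) + cos (y + 2 * pi * b%:~R * t)).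
  by apply: integrable01D; exact/continuous_integrable01/continuous_cos_affine.
have IH j : integrable01 (h j) by exact: integrable01Z.
rewrite E; split; first exact: integrable01_sum.
rewrite Rintegral01_sum //.
have F j : \int[lebesgue_measure]_(t in `[0, 1]) h j t =
    (sym_idx j == - n)%:R * ((sym_idx j)%:~R ^- (2 * k) / 2 * cos y) +
    (sym_idx j == n)%:R * ((sym_idx j)%:~R ^- (2 * k) / 2 * cos y).
  rewrite /h; have -> := RintegralZl _ _ (Ih (n + sym_idx j) (n - sym_idx j));
    last exact: measurable_itv.
  have -> := RintegralD _ (continuous_integrable01 (@continuous_cos_affine y (n + sym_idx j)))
    (continuous_integrable01 (@continuous_cos_affine y (n - sym_idx j)));
      last exact: measurable_itv.
  rewrite !Rintegral01_cos subr_eq0 [n == _]eq_sym [n + _]addrC addr_eq0.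
  by move: (_ ^- _) (cos y) (_%:R) (_%:R) => a b c d; ring.
rewrite (eq_bigr _ (fun j _ => F j)) big_split /=.
rewrite (sum_sym_idx M (- n) (fun m => m%:~R ^- (2 * k) / 2 * cos y)).
rewrite (sum_sym_idx M n (fun m => m%:~R ^- (2 * k) / 2 * cos y)).
rewrite abszN evenN_expV /cos_coef; case: ifP => _; last by rewrite addr0 mul0r.
by move: (_ ^- _) (cos y) => a b; field.
Qed.

(** Equal to [- (2 k)! / (2 pi i)^(2 k)], written with real numbers. *)
Definition bernoulli_const k : R := - ((-1) ^+ k * (2 * k)`!%:R / (2 * pi) ^+ (2 * k)).

Lemma bernoulli_approx k : (0 < k)%N -> exists2 C : R, 0 <= C & forall M x, 0 <= x <= 1 ->
  `|bernoulli_fun (2 * k) x - bernoulli_const k * cos_sum k M x| <= C / M.+1%:R.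
Proof.
move=> k0; have [C C0 HC] := fourier_error_bound R (2 * k).-2.
exists C => // M x x01; rewrite cos_sumE // -fourier_sum_even.
have := HC M x; rewrite in_itv /= => /(_ x01).
by rewrite (_ : (2 * k).-2.+2 = 2 * k)%N //; lia.
Qed.

Lemma frac_part_01 y : 0 <= frac_part y < 1.
Proof. by rewrite /frac_part subr_ge0 ltrBlDl floor_le_tmp -intrD1 lt_succ_floor. Qed.

(** Exponentials [e] multiply where cosines do not. Each cosine sum is already the full exponential
    sum, its sine part cancelling between opposite indices; real parts are taken at the end. *)
Lemma prod_cos_sum r (k : 'I_r -> nat) M (y : 'I_r -> R) :
  \prod_(i < r) cos_sum (k i) M (y i) =
  \sum_(f : {ffun 'I_r -> 'I_(2 * M).+1}) (\prod_i (sym_idx (f i))%:~R ^- (2 * k i)) *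
    cos (2 * pi * \sum_i (sym_idx (f i))%:~R * y i).
Proof.
pose e (t : R) : R[i] := (cos t +i* sin t)%C.
have eD s t : e (s + t) = e s * e t.
  by rewrite /e cosD sinD; simpc; rewrite [cos s * sin t + _]addrC.
have e0 : e 0 = 1 by rewrite /e cos0 sin0.
have esum (I : Type) (s : seq I) (F : I -> R) : e (\sum_(i <- s) F i) = \prod_(i <- s) e (F i).
  by elim: s => [|i s IH]; rewrite ?big_nil // !big_cons eD IH.
have cosS i : (cos_sum (k i) M (y i))%:C%C =
    \sum_(j < (2 * M).+1) ((sym_idx j)%:~R ^- (2 * k i))%:C%C * e (2 * pi * ((sym_idx j)%:~R
      * y i)).
  apply/eqP; rewrite eq_complex /= !raddf_sum /=; apply/andP; split; apply/eqP.
    by apply: eq_bigr => j _; rewrite /e /= mul0r subr0 mulrA.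
  symmetry; under eq_bigr => j _ do rewrite /= mul0r addr0.
  rewrite (sym_sum _ (fun n => n%:~R ^- (2 * k i) * sin (2 * pi * (n%:~R * y i)))).
  rewrite mul0r mulr0 sin0 mulr0 add0r big1 // => m _.
  by rewrite evenN_expV mulrNz mulNr mulrN sinN mulrN subrr.
transitivity (complex.Re (\prod_(i < r) (cos_sum (k i) M (y i))%:C%C)).
  by rewrite -rmorph_prod.
rewrite (eq_bigr _ (fun i _ => cosS i)) bigA_distr_bigA raddf_sum.
apply: eq_bigr => f _.
rewrite big_split /= -rmorph_prod -esum -mulr_sumr.
by rewrite /e; simpc.
Qed.

End CosSum.

(** * Uniform approximation of products *)

Section Approx.
Variables (R : realType) (X : Type) (D : X -> Prop).
Implicit Types (U W : X -> R) (u w : nat -> X -> R).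

(** The bound on [U] itself is carried along because the error of a product involves the sizes of
    the factors. *)
Definition approx U u := exists2 C : R, 0 <= C &
  forall M x, D x -> `|U x| <= C /\ `|U x - u M x| <= C / M.+1%:R.

Lemma approxM U u W w : approx U u -> approx W w ->
  approx (fun x => U x * W x) (fun M x => u M x * w M x).
Proof.
(* Here 3 = 1 + 2: one factor is approximated against [|U x| <= C], the other against
   [|w M x| <= 2 * C']. *)
move=> [C C0 HC] [C' C'0 HC']; exists (3 * (C * C')) => [|M x Dx].
  by rewrite !mulr_ge0.
have [U1 U2] := HC M x Dx; have [W1 W2] := HC' M x Dx.
have CC0 : 0 <= C * C' by rewrite mulr_ge0.
split; first by rewrite normrM (le_trans (ler_pM _ _ U1 W1)) // ler_peMl // ler1n.
have w2 : `|w M x| <= 2 * C'.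
  rewrite (_ : w M x = W x - (W x - w M x)); last by ring.
  rewrite (le_trans (ler_normB _ _)) // mulr_natl mulr2n lerD //.
  by rewrite (le_trans W2) // ler_pdivrMr // ler_peMr // ler1n.
have -> : U x * W x - u M x * w M x = U x * (W x - w M x) + (U x - u M x) * w M x by ring.
rewrite (le_trans (ler_normD _ _)) // !normrM.
have -> : 3 * (C * C') / M.+1%:R = C * (C' / M.+1%:R) + C / M.+1%:R * (2 * C') by ring.
by rewrite lerD // ler_pM.
Qed.

Lemma approx1 : approx (fun=> 1) (fun _ _ => 1).
Proof. exists 1 => [|M x _]; rewrite ?ler01 // subrr normr0 normr1; split=> //;
  rewrite divr_ge0. Qed.

Lemma approx_prod (I : Type) (s : seq I) (U : I -> X -> R) (u : I -> nat -> X -> R) :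
  (forall i, approx (U i) (u i)) ->
  approx (fun x => \prod_(i <- s) U i x) (fun M x => \prod_(i <- s) u i M x).
Proof.
move=> H; elim: s => [|i s IH].
  have [C C0 HC] := approx1; exists C => // M x Dx; rewrite !big_nil; exact: (HC M x Dx).
by have [C C0 HC] := approxM (H i) IH; exists C => // M x Dx; rewrite !big_cons; exact: HC.
Qed.

Lemma eq_approx U U' u u' : (forall x, D x -> U x = U' x) ->
  (forall M x, D x -> u M x = u' M x) -> approx U u -> approx U' u'.
Proof. by move=> UU uu [C C0 HC]; exists C => // M x Dx; rewrite -UU // -uu //; exact: HC. Qed.

Lemma approx_bernoulli k (y : X -> R) : (0 < k)%N -> (forall x, D x -> 0 <= y x <= 1) ->
  approx (fun x => bernoulli_fun (2 * k) (y x))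
         (fun M x => bernoulli_const R k * cos_sum k M (y x)).
Proof.
move=> k0 Dy; have [C C0 HC] := bernoulli_approx R k0; exists C => // M x /Dy yx.
split; last exact: HC.
(* At level 0 only the index 0 remains and the truncated sum is 0, so the error bound is a bound on
   the Bernoulli function. *)
have := HC 0%N _ yx; rewrite divr1 /cos_sum big_ord_recl big_ord0 /sym_idx /=.
by rewrite subrr exp0V // mul0r addr0 mulr0 subr0.
Qed.

End Approx.

(** * The integral as a limit of finite lattice sums *)

Section FourierIntegral.
Variables (R : realType) (V : vectType R) (r : nat).
Variables (N : seq V) (k : V -> nat) (ki : 'I_r -> nat) (c : V -> 'I_r -> int).
Hypotheses (uN : uniq N) (k0 : forall a, a \in N -> (0 < k a)%N)
  (ki0 : forall i, (0 < ki i)%N).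

Let F (x : V -> R) : R := (\prod_(a <- N) bernoulli_fun (2 * k a) (frac_part (x a))) *
  \prod_(i < r) bernoulli_fun (2 * ki i) (frac_part (- \sum_(a <- N) x a * (c a i)%:~R)).

Let const : R := (\prod_(a <- N) bernoulli_const R (k a)) * \prod_(i < r) bernoulli_const R
  (ki i).

(** Read [f] as the coordinates of a weight [v] in the fundamental weights and [c a i] as
    [<a^, lambda_i>]: the argument of [cos_coef] is then [<a^, v>]. *)
Definition fourier_lattice_sum M : R :=
  \sum_(f : {ffun 'I_r -> 'I_(2 * M).+1}) (\prod_i (sym_idx (f i))%:~R ^- (2 * ki i)) *
    \prod_(a <- N) cos_coef R (k a) M (\sum_i sym_idx (f i) * c a i).

Lemma fourier_iterated_integral M :
  let FM x := (\prod_(a <- N) cos_sum (k a) M (x a)) *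
     \prod_(i < r) cos_sum (ki i) M (- \sum_(a <- N) x a * (c a i)%:~R) in
  iint_ok N FM /\ iterated_integral N FM = fourier_lattice_sum M.
Proof.
move=> FM.
(* The frequency in the coordinate [a] once the phases are regrouped by roots. Its sign comes from
   the integrand and disappears at the end because [cos_coef] is even. *)
pose n (f : {ffun 'I_r -> 'I_(2 * M).+1}) a := - \sum_i sym_idx (f i) * c a i.
pose G f x := (\prod_(a <- N) cos_sum (k a) M (x a)) * cos (0 + 2 * pi * \sum_(a <- N) (n f
  a)%:~R * x a) : R.
pose w (f : {ffun 'I_r -> 'I_(2 * M).+1}) : R := \prod_i (sym_idx (f i))%:~R ^- (2 * ki i).
have HG f := @iterated_integral_fourier R V N _ _ (n f) 0 uN
   (fun a n y => (@cos_sum_fourier R (k a) M n y).1) (fun a n y =>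
     (@cos_sum_fourier R (k a) M n y).2).
have -> : FM = fun x => \sum_f w f * G f x.
  apply/funext => x; rewrite /FM prod_cos_sum mulr_sumr; apply: eq_bigr => f _.
  rewrite mulrCA /G add0r; congr (_ * (_ * cos (_ * _))).
  transitivity (\sum_i \sum_(a <- N) - ((sym_idx (f i))%:~R * (x a * (c a i)%:~R)) : R).
    by apply: eq_bigr => i _; rewrite mulrN mulr_sumr sumrN.
  rewrite exchange_big; apply: eq_bigr => a _.
  rewrite /n rmorphN rmorph_sum mulNr mulr_suml -sumrN; apply: eq_bigr => i _.
  by rewrite rmorphM /=; ring.
have HwG f := iterated_integralZ (w f) (HG f).1.
have [ok ->] := iterated_integral_sum (index_enum _) (fun f => (HwG f).1).
split=> //; apply: eq_bigr => f _; rewrite (HwG f).2 (HG f).2 cos0 mulr1; congr (_ * _).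
by apply: eq_bigr => a _; rewrite /cos_coef abszN evenN_expV.
Qed.

Lemma bernoulli_integral_approx : iint_ok N F -> exists2 C : R, 0 <= C & forall M,
  `|iterated_integral N F - const * fourier_lattice_sum M| <= C / M.+1%:R.
Proof.
move=> okF.
pose u M (x : V -> R) := (\prod_(a <- N) (bernoulli_const R (k a) * cos_sum (k a) M (x a))) *
     \prod_(i < r) (bernoulli_const R (ki i) * cos_sum (ki i) M (- \sum_(a <- N) x a * (c a
       i)%:~R)).
have : approx (@unit_cube R V) F u.
  apply: approxM.
    pose U (a : V) (x : V -> R) := if a \in N then bernoulli_fun (2 * k a) (frac_part (x a))
      else 1.
    pose v (a : V) M (x : V -> R) :=
      if a \in N then bernoulli_const R (k a) * cos_sum (k a) M (frac_part (x a)) else 1.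
    have : forall a, approx (@unit_cube R V) (U a) (v a).
      move=> a; rewrite /U /v; case aN: (a \in N); last exact: approx1.
      by apply: approx_bernoulli => [|x _]; [exact: k0 | have /andP[-> /ltW->] :=
        frac_part_01 (x a)].
    move=> /(approx_prod N); apply: eq_approx => [x|M x] _.
      by apply: eq_big_seq => a aN; rewrite /U aN.
    by apply: eq_big_seq => a aN; rewrite /v aN cos_sum_frac.
  apply: approx_prod => i.
  have : approx (@unit_cube R V)
    (fun x => bernoulli_fun (2 * ki i) (frac_part (- \sum_(a <- N) x a * (c a i)%:~R)))
    (fun M x => bernoulli_const R (ki i) * cos_sum (ki i) M (frac_part (- \sum_(a <- N) x a *
      (c a i)%:~R))).
    apply: approx_bernoulli => // x _; have /andP[-> /ltW->//] :=
      frac_part_01 (- \sum_(a <- N) x a * (c a i)%:~R).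
  by apply: eq_approx => // M x _; rewrite cos_sum_frac.
move=> [C C0 HC]; exists C => // M.
have [okM IM] := fourier_iterated_integral M.
have [okM' IM'] := iterated_integralZ const okM.
rewrite -IM -IM'; apply: iterated_integral_dist_le => // x x01.
have [_] := HC M x x01; congr (`|_ - _| <= _).
by rewrite /u !big_split /= /const; ring.
Qed.

End FourierIntegral.

(** * Fractional parts *)

Section FracPart.
Variable R : realType.
Implicit Types (y z t : R) (n : int) (m p Q : nat).

Lemma frac_part_eq n f : 0 <= f < 1 -> frac_part (n%:~R + f) = f :> R.
Proof.
move=> /andP[f0 f1]; rewrite /frac_part (@floor_def _ _ n); first by rewrite addrC addKr.
by rewrite lerDl f0 intrD ltrD2l.
Qed.

Lemma frac_part_id f : 0 <= f < 1 -> frac_part f = f :> R.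
Proof. by move=> f01; rewrite -[X in frac_part X]add0r (frac_part_eq 0). Qed.

Lemma frac_partD_int n y : frac_part (n%:~R + y) = frac_part y.
Proof.
rewrite -[in LHS](subrK (Num.floor y)%:~R y) [y - _ + _]addrC addrA -intrD.
by rewrite frac_part_eq // frac_part_01.
Qed.

Lemma floor_frac_part y : (Num.floor y)%:~R = y - frac_part y.
Proof. by rewrite /frac_part subKr. Qed.

Lemma frac_part_frac_add z y : frac_part (y + frac_part z) = frac_part (y + z).
Proof.
by rewrite -(frac_partD_int (Num.floor z)) /frac_part addrCA [_ + (z - _)]addrC subrK.
Qed.

Lemma frac_partN y : y \isn't a Num.int -> frac_part (- y) = 1 - frac_part y.
Proof.
move=> yint; have /andP[f0 f1] := frac_part_01 y.
have f0' : 0 < frac_part y.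
  rewrite lt_neqAle f0 andbT eq_sym; apply: contra yint => /eqP f00.
  by rewrite -(subr0 y) -f00 -floor_frac_part intr_int.
rewrite -(frac_part_eq (- Num.floor y - 1) (f := 1 - frac_part y)); last lra.
by congr frac_part; rewrite intrB intrN floor_frac_part; lra.
Qed.

(* Hermite's identity *)
Lemma frac_part_mul p y : (0 < p)%N ->
  frac_part (p%:R * y) = \sum_(i < p) frac_part (y + i%:R / p%:R) - (p%:R - 1) / 2.
Proof.
move=> p0; have pR : 0 < p%:R :> R by rewrite ltr0n.
(* This defect has period [1 / p], so it may be evaluated at the point [s] of [[0, 1 / p[] below,
   where none of the fractional parts wraps around. *)
pose h z : R := \sum_(i < p) frac_part (z + i%:R / p%:R) - frac_part (p%:R * z).
have hS z : h (z + p%:R^-1) = h z.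
  rewrite /h mulrDr divff ?gt_eqF // [_ * z + 1]addrC (frac_partD_int 1).
  have E (i : nat) : p%:R^-1 + i%:R / p%:R = i.+1%:R / p%:R :> R.
    by rewrite -nat1r mulrDl mul1r.
  congr (_ - _); case: p p0 pR E {h} => // p _ pR E.
  rewrite big_ord_recr [in RHS]big_ord_recl /= mul0r addr0 addrC; congr (_ + _).
    rewrite -addrA E divff ?gt_eqF //.
    by rewrite addrC (frac_partD_int 1).
  apply: eq_bigr => i _; congr frac_part.
  by rewrite -addrA E.
have hn z (j : nat) : h (z + j%:R / p%:R) = h z.
  elim: j => [|j IH]; first by rewrite mul0r addr0.
  by rewrite -natr1 mulrDl mul1r addrA hS IH.
suff : h y = (p%:R - 1) / 2 by rewrite /h; lra.
pose s : R := frac_part (p%:R * y) / p%:R.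
have /andP[f0 f1] := frac_part_01 (p%:R * y).
have Ey : y = s + (Num.floor (p%:R * y))%:~R / p%:R.
  by rewrite /s floor_frac_part -mulrDl addrC subrK mulrAC divff ?mul1r // gt_eqF.
have -> : h y = h s.
  rewrite {1}Ey; case: (Num.floor _) => j; first exact: hn.
  by rewrite NegzE mulrNz mulNr -[RHS](hn _ j.+1) -[LHS](hn _ j.+1) subrK hn.
have ps : p%:R * s = frac_part (p%:R * y) by rewrite mulrC divfK // gt_eqF.
have s0 : 0 <= s by rewrite divr_ge0.
rewrite /h ps (frac_part_id _) ?f0 //.
rewrite (eq_bigr (fun i : 'I_p => s + i%:R / p%:R)) => [|i _]; last first.
  apply: frac_part_id; rewrite addr_ge0 ?divr_ge0 //= /s -mulrDl ltr_pdivrMr // mul1r.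
  apply: (@lt_le_trans _ _ (1 + i%:R)); first by rewrite ltrD2r.
  by rewrite nat1r ler_nat.
rewrite big_split /= sumr_const card_ord -[s *+ p]mulr_natl ps addrAC subrr add0r -mulr_suml.
have -> : \sum_(i < p) i%:R = p%:R * (p%:R - 1) / 2 :> R.
  clear; elim: p => [|p IH]; first by rewrite big_ord0 !mul0r.
  by rewrite big_ord_recr /= IH -natr1; field.
by rewrite -mulrA mulrAC divff ?mul1r // gt_eqF.
Qed.

Lemma measurable_floor : measurable_fun setT (fun t : R => (Num.floor t)%:~R : R).
Proof.
apply: nondecreasing_measurable => // s t st; rewrite ler_int.
by rewrite floor_ge_int (le_trans (floor_le s)).
Qed.

Lemma measurable_frac_part_affine (a b : R) :
  measurable_fun setT (fun t => frac_part (a * t + b)).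
Proof.
apply: measurable_funB; last apply: (measurableT_comp measurable_floor);
  by apply: measurable_funD => //; apply: measurable_funM.
Qed.

Lemma bounded_measurable_integrable01 (f : R -> R) C :
  measurable_fun setT f -> (forall t, `|f t| <= C) -> integrable01 f.
Proof.
move=> mf fC.
have mu01 : (@lebesgue_measure R `[(0 : R)%R, 1%R]%classic < +oo)%E.
  by rewrite lebesgue_measure_itv /= lte_fin ltr01 -EFinB ltry.
apply: measurable_bounded_integrable.
- exact: measurable_itv.
- exact: mu01.
- exact: measurable_funTS.
- by exists C; split; [exact: num_real | move=> x Cx t _; rewrite /= (le_trans (fC t)) // ltW].
Qed.

Lemma ae_Rintegral01 (f g : R -> R) :
  measurable_fun setT f -> measurable_fun setT g ->
  {ae lebesgue_measure, forall t, f t = g t} ->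
  \int[lebesgue_measure]_(t in `[0, 1]) f t = \int[lebesgue_measure]_(t in `[0, 1]) g t.
Proof.
move=> mf mg fg; rewrite /Rintegral; congr fine; apply: ae_eq_integral.
- exact: measurable_itv.
- exact/measurable_EFinP/measurable_funTS.
- exact/measurable_EFinP/measurable_funTS.
- by apply: (@filterS _ _ (ae_filter_ringOfSetsType _) _ _ _ fg) => t /= -> _.
Qed.

Lemma ae_imply2 (P Q S : R -> Prop) : (forall t, P t -> Q t -> S t) ->
  {ae lebesgue_measure, forall t, P t} -> {ae lebesgue_measure, forall t, Q t} ->
  {ae lebesgue_measure, forall t, S t}.
Proof.
move=> PQS HP HQ; have H := @filterI _ _ (ae_filter_ringOfSetsType _) _ _ HP HQ.
by apply: (@filterS _ _ (ae_filter_ringOfSetsType _) _ _ _ H) => t [/PQS] /[apply].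
Qed.

Lemma ae_not_int (a b : R) : a != 0 ->
  {ae lebesgue_measure, forall t : R, a * t + b \isn't a Num.int}.
Proof.
move=> a0; set A := range (fun n : int => (n%:~R - b) / a : R).
have cA : countable A by apply: sub_countable (card_image_le _ _) _.
exists A; split; first exact: countable_measurable.
  exact: countable_lebesgue_measure0.
move=> t /= /negP; rewrite negbK => /intrP[n Hn]; exists n => //.
by rewrite -Hn addrK mulrAC divff // mul1r.
Qed.

End FracPart.

(** * Integrals of powers of one sawtooth function *)

Section FracIntegral.
Variable R : realType.
Implicit Types (y z t : R) (m Q : nat).
Local Notation mu := (@lebesgue_measure R).

Lemma Rintegral_FTC (f F : R -> R) (a b : R) : a <= b -> continuous f ->
  (forall x : R, is_derive x 1 F (f x)) ->
  \int[mu]_(t in `[a, b]) f t = F b - F a.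
Proof.
rewrite le_eqVlt => /predU1P[<- _ _|ab cf dF].
  by rewrite set_itv1 Rintegral_set1 subrr.
have cF : continuous F.
  by move=> x; apply/differentiable_continuous/derivable1_diffP; have [] := dF x.
rewrite /Rintegral (@continuous_FTC2 _ f F) //.
- exact: continuous_subspaceT.
- split => [x _||]; first by have [] := dF x.
  + exact/cvg_at_right_filter/cF.
  + exact/cvg_at_left_filter/cF.
- by move=> x _; rewrite derive1E; apply: derive_val.
Qed.

Lemma continuous_affine_pow m (a b : R) : continuous (fun t => (t * a + b) ^+ m).
Proof.
move=> t; apply: (@continuous_comp _ _ _ (fun t => t * a + b) (fun u => u ^+ m));
  last exact: exprn_continuous.
by apply: cvgD; [apply: mulrr_continuous | exact: cvg_cst].
Qed.

Lemma Rintegral_affine_pow m (a b u v : R) : a != 0 -> u <= v ->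
  \int[mu]_(t in `[u, v]) ((t * a + b) ^+ m) =
  (a * m.+1%:R)^-1 * ((v * a + b) ^+ m.+1 - (u * a + b) ^+ m.+1).
Proof.
move=> a0 uv.
have dF (x : R) : is_derive x 1 (fun t => (a * m.+1%:R)^-1 * (t * a + b) ^+ m.+1) ((x * a +
  b) ^+ m).
  have d1 : is_derive x 1 (horner (a *: 'X + b%:P)) a.
    apply: (is_derive_eq (is_derive_poly _ _)).
    by rewrite derivD derivZ derivX derivC addr0 hornerE hornerC mulr1.
  have d2 := is_derive_scale (a * m.+1%:R)^-1 (is_deriveX m.+1 d1).
  rewrite (_ : (fun t => _) = (fun t => (a * m.+1%:R)^-1 * (horner (a *: 'X + b%:P) ^+ m.+1) t)).
    apply: (is_derive_eq d2); rewrite !hornerE /= [a * x]mulrC /GRing.scale /=.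
    have : m.+1%:R != 0 :> R by rewrite pnatr_eq0.
    by move: (_ ^+ m) (m.+1%:R : R) => e n n0; field; rewrite a0 n0.
  by apply/funext => t; rewrite exprfctE !hornerE [a * t]mulrC.
by rewrite (Rintegral_FTC uv (@continuous_affine_pow m a b) dF) -mulrBr.
Qed.

(** The affine form moves by [1 / Q <= 1], hence passes at most one integer. The sum of the first
    three terms is 1 or 0 according to whether it does, so that a single polynomial in fractional
    parts covers both cases. *)
Lemma Rintegral_frac_part_pow m Q z : (0 < Q)%N ->
  \int[mu]_(t in `[0, 1]) (frac_part (t * Q%:R^-1 + z) ^+ m) =
  Q%:R / m.+1%:R * (Q%:R^-1 + frac_part z - frac_part (z + Q%:R^-1)
    + frac_part (z + Q%:R^-1) ^+ m.+1 - frac_part z ^+ m.+1).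
Proof.
move=> Q0; set w := frac_part z; set q : R := Q%:R^-1.
have QR : 1 <= Q%:R :> R by rewrite ler1n.
have q0 : 0 < q by rewrite invr_gt0 ltr0n.
have q1 : q <= 1 by rewrite invf_le1 // ltr0n.
have qn0 : q != 0 by rewrite gt_eqF.
have -> : Q%:R = q^-1 by rewrite invrK.
have /andP[w0 w1] : 0 <= w < 1 := frac_part_01 z.
have fz y : frac_part (y + z) = frac_part (y + w) by rewrite frac_part_frac_add.
rewrite [z + q]addrC fz; under eq_Rintegral do rewrite fz.
have c0 : q^-1 / m.+1%:R = (q * m.+1%:R)^-1 by rewrite invfM.
have int_pow (a b u v : R) : mu.-integrable `[u, v] (EFin \o (fun t => (t * a + b) ^+ m)).
  apply: continuous_compact_integrable; first exact: segment_compact.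
  exact/continuous_subspaceT/continuous_affine_pow.
have [wq|wq] := ltP (w + q) 1.
  have E t : 0 <= t <= 1 -> frac_part (t * q + w) = t * q + w.
    by move=> /andP[t0 t1]; apply: frac_part_id; apply/andP; split; nra.
  have -> : \int[mu]_(t in `[0, 1]) (frac_part (t * q + w) ^+ m) =
      \int[mu]_(t in `[0, 1]) ((t * q + w) ^+ m).
    by apply: eq_Rintegral => t; rewrite inE /= in_itv /= => /E ->.
  rewrite Rintegral_affine_pow // (frac_part_id (f := q + w)); last by lra.
  by rewrite c0 mul1r mul0r add0r; congr (_ * _); ring.
(* The parameter at which [t * q + w] reaches 1 and its fractional part drops to 0. *)
pose t0 := (1 - w) / q.
have t0q : t0 * q = 1 - w by rewrite /t0 divfK.
have t00 : 0 <= t0 by rewrite divr_ge0 ?(ltW q0) // subr_ge0 ltW.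
have t01 : t0 <= 1 by rewrite ler_pdivrMr //; lra.
have E1 t : 0 <= t -> t < t0 -> frac_part (t * q + w) = t * q + w.
  by move=> ? ?; apply: frac_part_id; apply/andP; split; nra.
have E2 t : t0 <= t -> t <= 1 -> frac_part (t * q + w) = t * q + (w - 1).
  move=> ? ?; rewrite -(frac_partD_int (-1)).
  have -> : (-1)%:~R + (t * q + w) = t * q + (w - 1) by rewrite mulrN1z; ring.
  by apply: frac_part_id; apply/andP; split; nra.
have If : mu.-integrable `[0, 1] (EFin \o (fun t => frac_part (t * q + w) ^+ m)).
  apply: (@bounded_measurable_integrable01 _ _ 1).
    apply: measurable_funX.
    by under eq_fun do rewrite mulrC; exact: measurable_frac_part_affine.
  move=> t; have /andP[f0 f1] := frac_part_01 (t * q + w).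
  by rewrite ger0_norm ?exprn_ge0 // exprn_ile1 // ltW.
have -> : \int[mu]_(t in `[0, 1]) (frac_part (t * q + w) ^+ m) =
   \int[mu]_(t in `[0, t0]) ((t * q + w) ^+ m) + \int[mu]_(t in `[t0,
     1]) ((t * q + (w - 1)) ^+ m).
  have := @Rintegral_itvB R (fun t => frac_part (t * q + w) ^+ m) (BLeft 0) (BRight 1) t0 If.
  rewrite !bnd_simp => /(_ t00 t01) /eqP; rewrite subr_eq addrC => /eqP ->; congr (_ + _).
    have I1 : mu.-integrable `[0, t0[ (EFin \o (fun t => frac_part (t * q + w) ^+ m)).
      by apply: integrableS If => // t /=; rewrite !in_itv /= => /andP[-> /ltW/le_trans]; apply.
    rewrite -(Rintegral_itv_bndo_bndc I1).
    have I2 : mu.-integrable `[0, t0[ (EFin \o (fun t => (t * q + w) ^+ m)).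
      by apply: integrableS (int_pow q w 0 t0) => // t /=; rewrite !in_itv /= => /andP[-> /ltW].
    rewrite -(Rintegral_itv_bndo_bndc I2).
    by apply: eq_Rintegral => t; rewrite inE /= in_itv /= => /andP[? ?]; rewrite E1.
  have I2 : mu.-integrable `]t0, 1] (EFin \o (fun t => (t * q + (w - 1)) ^+ m)).
    by apply: integrableS (int_pow q (w - 1) t0 1) => // t /=; rewrite !in_itv /= =>
      /andP[/ltW-> ->].
  rewrite -(Rintegral_itv_obnd_cbnd I2).
  by apply: eq_Rintegral => t; rewrite inE /= in_itv /= => /andP[/ltW ? ?]; rewrite E2.
have fqw : frac_part (q + w) = q + w - 1.
  by have := E2 1 t01 (lexx 1); rewrite mul1r => ->; rewrite addrA.
rewrite !Rintegral_affine_pow // fqw c0 t0q mul0r mul1r add0r.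
have -> : 1 - w + w = 1 by ring.
have -> : 1 - w + (w - 1) = 0 by ring.
have -> : q + (w - 1) = q + w - 1 by ring.
by rewrite expr1n expr0n /=; ring.
Qed.

End FracIntegral.

(** * The algebra generated by fractional parts of affine forms *)

(** [chi] is an integer, and the ranges of the three fractional parts confine it to the open
    interval from -1 to 2. *)
Lemma frac_part_carry (R : realType) (u v : R) :
  let chi := frac_part v - frac_part u + frac_part (u - v) in chi = 0 \/ chi = 1.
Proof.
move=> chi; pose n := Num.floor u - Num.floor v - Num.floor (u - v).
have En : chi = n%:~R by rewrite /n !intrB !floor_frac_part /chi; ring.
have /andP[a0 a1] := frac_part_01 u; have /andP[b0 b1] := frac_part_01 v.
have /andP[c0 c1] := frac_part_01 (u - v).
have : (-1)%:~R < n%:~R :> R by rewrite -En /chi mulrN1z; lra.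
have : n%:~R < 2%:~R :> R by rewrite -En /chi; lra.
rewrite En !ltr_int => n2 n1; have [->|->] : n = 0 \/ n = 1 by lia.
  by left.
by right.
Qed.

Section FracAlgebra.
Variables (R : realType) (V : vectType R) (N : seq V) (P : R -> Prop).
Hypotheses (uN : uniq N) (Pq : forall q : rat, P (ratr q)).
Hypotheses (PD : forall x y, P x -> P y -> P (x + y)) (PM : forall x y, P x -> P y -> P (x * y)).
Implicit Types (x : V -> R) (t : R) (a b : V) (F G : (V -> R) -> R).
Implicit Types (p : (V -> R) -> R -> R).

Definition affine (q0 : R) (q : V -> rat) x : R := q0 + \sum_(b <- N) ratr (q b) * x b.

(* With [P] the rationals this yields rational integrals; with [P] all reals it is
   also stable under fixing a variable, which yields integrability. *)
Inductive frac_alg : ((V -> R) -> R) -> Prop :=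
| frac_alg_cst c0 : P c0 -> frac_alg (fun=> c0)
| frac_alg_frac q0 q : P q0 -> frac_alg (fun x => frac_part (affine q0 q x))
| frac_algD F G : frac_alg F -> frac_alg G -> frac_alg (fun x => F x + G x)
| frac_algM F G : frac_alg F -> frac_alg G -> frac_alg (fun x => F x * G x).

Let P1 : P 1. Proof. by rewrite -(rmorph1 (@ratr R)); exact: Pq. Qed.
Let Pnat n : P n%:R. Proof. by rewrite -(ratr_nat R); exact: Pq. Qed.
Let PN y : P y -> P (- y).
Proof. by rewrite -mulN1r -(rmorphN1 (@ratr R)); apply: PM; exact: Pq. Qed.
Let P0 : P 0. Proof. by rewrite -(rmorph0 (@ratr R)); exact: Pq. Qed.

Lemma frac_algX F n : frac_alg F -> frac_alg (fun x => F x ^+ n).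
Proof.
move=> AF; elim: n => [|n IH]; first exact: (frac_alg_cst P1).
by under eq_fun do rewrite exprS; exact: frac_algM.
Qed.

Lemma frac_alg_sum (I : Type) (s : seq I) (F : I -> (V -> R) -> R) :
  (forall i, frac_alg (F i)) -> frac_alg (fun x => \sum_(i <- s) F i x).
Proof.
move=> AF; elim: s => [|i s IH].
  by under eq_fun do rewrite big_nil; exact: (frac_alg_cst P0).
by under eq_fun do rewrite big_cons; exact: frac_algD.
Qed.

Lemma frac_alg_prod (I : eqType) (s : seq I) (F : I -> (V -> R) -> R) :
  (forall i, i \in s -> frac_alg (F i)) -> frac_alg (fun x => \prod_(i <- s) F i x).
Proof.
elim: s => [|i s IH] AF.
  by under eq_fun do rewrite big_nil; exact: (frac_alg_cst P1).
under eq_fun do rewrite big_cons; apply: frac_algM; first by apply: AF; rewrite mem_head.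
by apply: IH => j js; apply: AF; rewrite in_cons js orbT.
Qed.

Lemma frac_alg_poly (p : {poly rat}) F : frac_alg F ->
  frac_alg (fun x => (map_poly ratr p).[F x]).
Proof.
move=> AF; under eq_fun do rewrite horner_coef.
apply: frac_alg_sum => i; apply: frac_algM; last exact: frac_algX.
by rewrite coef_map /=; apply: frac_alg_cst; exact: Pq.
Qed.

Lemma frac_alg_bounded F : frac_alg F -> exists C, forall x, `|F x| <= C.
Proof.
elim=> [c0 _|q0 q _|{}F G _ [C HC] _ [C' HC']|{}F G _ [C HC] _ [C' HC']].
- by exists `|c0|.
- exists 1 => x; have /andP[f0 /ltW f1] := frac_part_01 (affine q0 q x).
  by rewrite ger0_norm.
- by exists (C + C') => x; rewrite (le_trans (ler_normD _ _)) // lerD.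
- by exists (C * C') => x; rewrite normrM ler_pM.
Qed.

Section OneVariable.
Variable a : V.
Hypothesis aN : a \in N.

Definition zero_at (q : V -> rat) : V -> rat := fun b => if b == a then 0 else q b.

Lemma affine_upd q0 q t x : affine q0 q (upd a t x) = ratr (q a) * t + affine q0 (zero_at q) x.
Proof.
rewrite /affine !(bigD1_seq a) //= /upd /zero_at eqxx rmorph0 mul0r add0r addrCA.
by congr (_ + (_ + _)); apply: eq_bigr => b /negbTE ->.
Qed.

Definition indep F := forall t x, F (upd a t x) = F x.

Lemma affine_indep q0 q : q a = 0 -> indep (affine q0 q).
Proof.
move=> qa t x; rewrite affine_upd qa rmorph0 mul0r add0r; congr (_ + _).
by apply: eq_bigr => b _; rewrite /zero_at; case: eqP => // ->; rewrite qa.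
Qed.

Lemma frac_alg_measurable F x : frac_alg F -> measurable_fun setT (fun t => F (upd a t x)).
Proof.
elim=> [c0 _|q0 q _|{}F G _ mF _ mG|{}F G _ mF _ mG].
- exact: measurable_cst.
- under eq_fun do rewrite affine_upd; exact: measurable_frac_part_affine.
- exact: measurable_funD.
- exact: measurable_funM.
Qed.

Lemma frac_alg_integrable F x : frac_alg F -> integrable01 (fun t => F (upd a t x)).
Proof.
move=> AF; have [C HC] := frac_alg_bounded AF.
apply: (@bounded_measurable_integrable01 _ _ C) => //; exact: frac_alg_measurable.
Qed.

Section FixedDenominator.
Variable Q : nat.
Hypothesis Q0 : (0 < Q)%N.

(** With a common slope [1 / Q], the difference of two arguments is free of [t]. *)
Definition sawtooth (z0 : R) (z : V -> rat) : (V -> R) -> R -> R :=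
  fun x t => frac_part (t * Q%:R^-1 + affine z0 z x).

(* Linear combinations of powers of sawtooth functions of period [Q]; that no
   products of distinct sawtooth functions are needed is [sawtooth_spanM]. *)
Inductive sawtooth_span : ((V -> R) -> R -> R) -> Prop :=
| sawtooth_span_pow (c : (V -> R) -> R) z0 z m : frac_alg c -> indep c -> P z0 -> z a = 0 ->
    sawtooth_span (fun x t => c x * sawtooth z0 z x t ^+ m)
| sawtooth_spanD p p' : sawtooth_span p -> sawtooth_span p' ->
    sawtooth_span (fun x t => p x t + p' x t).

Lemma eq_sawtooth_span p p' : (forall x t, p x t = p' x t) ->
  sawtooth_span p -> sawtooth_span p'.
Proof. by move=> pp'; rewrite (_ : p = p') //; apply/funext => x; apply/funext => t. Qed.

Lemma sawtooth_spanZ c p : frac_alg c -> indep c -> sawtooth_span p ->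
  sawtooth_span (fun x t => c x * p x t).
Proof.
move=> Ac ic; elim=> [c' z0 z m Ac' ic' Pz za|{}p p' _ IH _ IH'].
  apply: (@eq_sawtooth_span (fun x t => (c x * c' x) * sawtooth z0 z x t ^+ m)).
    by move=> x t; rewrite mulrA.
  apply: sawtooth_span_pow => //; first exact: frac_algM.
  by move=> t x; rewrite ic ic'.
by apply: eq_sawtooth_span (sawtooth_spanD IH IH') => x t; rewrite mulrDr.
Qed.

Lemma sawtooth_span_cst c : frac_alg c -> indep c -> sawtooth_span (fun x t => c x).
Proof.
move=> Ac ic; apply: (@eq_sawtooth_span (fun x t => c x * sawtooth 0 (fun=> 0) x t ^+ 0)).
  by move=> x t; rewrite expr0 mulr1.
by apply: sawtooth_span_pow.
Qed.

Lemma sawtooth_spanZ0 c0 p : P c0 -> sawtooth_span p -> sawtooth_span (fun x t => c0 * p x t).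
Proof. by move=> Pc; apply: (@sawtooth_spanZ (fun=> c0)) => //; exact: frac_alg_cst. Qed.

Lemma sawtooth_spanB p p' : sawtooth_span p -> sawtooth_span p' ->
  sawtooth_span (fun x t => p x t - p' x t).
Proof.
move=> Sp Sp'; apply: (eq_sawtooth_span _ (sawtooth_spanD Sp (sawtooth_spanZ0 (PN P1) Sp'))).
by move=> x t; rewrite mulN1r.
Qed.

Lemma sawtooth_span_sum n (p : 'I_n -> (V -> R) -> R -> R) :
  (forall i, sawtooth_span (p i)) -> sawtooth_span (fun x t => \sum_i p i x t).
Proof.
elim: n p => [|n IH] p Sp.
  apply: (@eq_sawtooth_span (fun x t => 0)); first by move=> x t; rewrite big_ord0.
  by apply: (@sawtooth_span_cst (fun=> 0)) => //; exact: (frac_alg_cst P0).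
apply: (@eq_sawtooth_span (fun x t => p ord0 x t + \sum_i p (lift ord0 i) x t)).
  by move=> x t; rewrite big_ord_recl.
by apply: sawtooth_spanD => //; exact: IH.
Qed.

Section Product.
Variables (z0 w0 : R) (z w : V -> rat).
Hypotheses (Pz0 : P z0) (Pw0 : P w0) (za : z a = 0) (wa : w a = 0).
Let u := sawtooth z0 z.
Let v := sawtooth w0 w.
Let d x := frac_part (affine (z0 - w0) (fun b => z b - w b) x).
Let chi x t := v x t - u x t + d x.

Let Ad : frac_alg d. Proof. by apply: frac_alg_frac; apply: PD => //; exact: PN. Qed.

Let id : indep d.
Proof. by move=> t x; rewrite /d affine_indep // za wa subrr. Qed.

Let chi01 x t : chi x t = 0 \/ chi x t = 1.
Proof.
have -> : chi x t = v x t - u x t +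
    frac_part ((t * Q%:R^-1 + affine z0 z x) - (t * Q%:R^-1 + affine w0 w x)).
  congr (_ + frac_part _); rewrite opprD addrACA subrr add0r /affine opprD addrACA -sumrB;
    congr (_ + _).
  by apply: eq_bigr => b _; rewrite rmorphB mulrBl.
exact: frac_part_carry.
Qed.

Let upow m : sawtooth_span (fun x t => u x t ^+ m).
Proof.
apply: (@eq_sawtooth_span (fun x t => 1 * u x t ^+ m)); first by move=> x t; rewrite mul1r.
by apply: (@sawtooth_span_pow (fun=> 1)) => //; exact: (frac_alg_cst P1).
Qed.

Let vdpow m : sawtooth_span (fun x t => (v x t + d x) ^+ m).
Proof.
pose p (i : 'I_m.+1) x t := ('C(m, i)%:R * d x ^+ i) * v x t ^+ (m - i).
apply: (@eq_sawtooth_span (fun x t => \sum_i p i x t)).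
  move=> x t; rewrite exprDn; apply: eq_bigr => i _.
  by rewrite /p -mulrA mulr_natl [d x ^+ _ * _]mulrC.
apply: sawtooth_span_sum => i; apply: sawtooth_span_pow => //.
  apply: frac_algM; [exact: (frac_alg_cst (Pnat _)) | exact: frac_algX].
by move=> t x; rewrite id.
Qed.

(* The Bernoulli polynomials provide discrete antiderivatives. *)
Let chi_upow m : sawtooth_span (fun x t => chi x t * u x t ^+ m).
Proof.
(* As [chi] is 0 or 1, [B_(m+1) (u + chi) - B_(m+1) u = (m + 1) chi u^m]; since [u + chi = v + d],
   the left side contains powers of [u] and of [v] but no mixed products. *)
apply: (@eq_sawtooth_span (fun x t => ratr m.+1%:R^-1 *
   (bernoulli_fun m.+1 (v x t + d x) - bernoulli_fun m.+1 (u x t)))).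
  move=> x t; have m0 : m.+1%:R != 0 :> R by rewrite pnatr_eq0.
  rewrite fmorphV rmorph_nat.
  have E : v x t + d x = u x t + chi x t by rewrite /chi; ring.
  have [c0|c1] := chi01 x t; first by rewrite E c0 addr0 subrr mulr0 mul0r.
  by rewrite E c1 bernoulli_fun_shift addrAC subrr add0r mul1r mulKf.
apply: sawtooth_spanZ0; first exact: Pq.
apply: sawtooth_spanB.
  apply: (eq_sawtooth_span (p := fun x t => \sum_(i < size (map_poly (@ratr R)
    (bernoulli_poly m.+1)))
     (map_poly ratr (bernoulli_poly m.+1))`_i * (v x t + d x) ^+ i)).
    by move=> x t; rewrite /bernoulli_fun horner_coef.
  by apply: sawtooth_span_sum => i; apply: sawtooth_spanZ0 => //; rewrite coef_map; exact: Pq.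
apply: (eq_sawtooth_span (p := fun x t => \sum_(i < size (map_poly (@ratr R) (bernoulli_poly
  m.+1)))
   (map_poly ratr (bernoulli_poly m.+1))`_i * u x t ^+ i)).
  by move=> x t; rewrite /bernoulli_fun horner_coef.
by apply: sawtooth_span_sum => i; apply: sawtooth_spanZ0 => //; rewrite coef_map; exact: Pq.
Qed.

(** Induction on [n], replacing one factor [v] by [u - d + chi]. The version multiplied by [chi]
    must be carried along; it closes up because [chi] is idempotent. *)
Lemma sawtooth_span_powM m n : sawtooth_span (fun x t =>
  sawtooth z0 z x t ^+ m * sawtooth w0 w x t ^+ n).
Proof.
suff : (forall m, sawtooth_span (fun x t => u x t ^+ m * v x t ^+ n)) /\
       (forall m, sawtooth_span (fun x t => chi x t * (u x t ^+ m * v x t ^+ n))) by case.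
elim: n {m} => [|n [IH1 IH2]].
  split=> m; [apply: eq_sawtooth_span (upow m) | apply: eq_sawtooth_span (chi_upow m)];
    by move=> x t; rewrite expr0 mulr1.
split=> m.
  have H := sawtooth_spanD (sawtooth_spanB (IH1 m.+1) (sawtooth_spanZ Ad id (IH1 m))) (IH2 m).
  by apply: eq_sawtooth_span H => x t; rewrite !exprS /chi; ring.
have H := sawtooth_spanD (sawtooth_spanB (IH2 m.+1) (sawtooth_spanZ Ad id (IH2 m))) (IH2 m).
apply: eq_sawtooth_span H => x t; rewrite !exprS.
have E : v x t = u x t - d x + chi x t by rewrite /chi; ring.
have [->|c1] := chi01 x t; first by ring.
by rewrite [X in _ = _ * (_ * (X * _))]E c1; ring.
Qed.

End Product.

Lemma sawtooth_spanM p p' : sawtooth_span p -> sawtooth_span p' ->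
  sawtooth_span (fun x t => p x t * p' x t).
Proof.
move=> Sp; elim: Sp p' => [c z0 z m Ac ic Pz za|{}p q _ IHp _ IHq] p' Sp'; last first.
  apply: eq_sawtooth_span (sawtooth_spanD (IHp _ Sp') (IHq _ Sp')) => x t.
  by rewrite mulrDl.
elim: Sp' => [c' w0 w n Ac' ic' Pw wa|{}p' q _ IHp _ IHq]; last first.
  apply: eq_sawtooth_span (sawtooth_spanD IHp IHq) => x t; by rewrite mulrDr.
have H := sawtooth_spanZ Ac ic (sawtooth_spanZ Ac' ic' (sawtooth_span_powM Pz Pw za wa m n)).
by apply: eq_sawtooth_span H => x t; ring.
Qed.

Lemma measurable_sawtooth z0 z x : measurable_fun setT (sawtooth z0 z x).
Proof.
by rewrite /sawtooth; under eq_fun do rewrite mulrC; exact: measurable_frac_part_affine.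
Qed.

Lemma sawtooth_span_measurable p x : sawtooth_span p -> measurable_fun setT (p x).
Proof.
elim=> [c z0 z m _ _ _ _|{}p p' _ mp _ mp']; last exact: measurable_funD.
by apply: measurable_funM => //; apply: measurable_funX; exact: measurable_sawtooth.
Qed.

Let sawtooth_integrable z0 z x m : integrable01 (fun t => sawtooth z0 z x t ^+ m).
Proof.
apply: (@bounded_measurable_integrable01 _ _ 1).
  by apply: measurable_funX; exact: measurable_sawtooth.
move=> t; have /andP[f0 f1] := frac_part_01 (t * Q%:R^-1 + affine z0 z x).
by rewrite ger0_norm ?exprn_ge0 // exprn_ile1 // ltW.
Qed.

(** The integral of a power is a polynomial in the fractional parts of [z] and [z + 1 / Q], and the
    shift by [1 / Q] keeps the constant in [P]. *)
Lemma sawtooth_span_integral p : sawtooth_span p ->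
  (forall x, integrable01 (p x)) /\
  frac_alg (fun x => \int[lebesgue_measure]_(t in `[0, 1]) p x t).
Proof.
elim=> [c z0 z m Ac ic Pz za|{}p p' _ [ip Ap] _ [ip' Ap']]; last first.
  split=> [x|]; first exact: integrable01D.
  under eq_fun => x do (have -> := RintegralD _ (ip x) (ip' x); last exact: measurable_itv).
  exact: frac_algD.
split=> [x|]; first exact: integrable01Z.
under eq_fun => x do (have -> := RintegralZl _ _ (sawtooth_integrable z0 z x m);
  last exact: measurable_itv).
apply: frac_algM => //.
under eq_fun => x do rewrite Rintegral_frac_part_pow //.
have A0 : frac_alg (fun x => frac_part (affine z0 z x)) by exact: frac_alg_frac.
have A1 : frac_alg (fun x => frac_part (affine z0 z x + Q%:R^-1)).
  have : frac_alg (fun x => frac_part (affine (z0 + Q%:R^-1) z x)).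
    by apply: frac_alg_frac; apply: PD => //; rewrite -(ratr_nat R) -fmorphV; exact: Pq.
  by under eq_fun do rewrite /affine addrAC.
have AN F : frac_alg F -> frac_alg (fun x => - F x).
  by move=> AF; under eq_fun do rewrite -mulN1r; apply: frac_algM => //;
    exact: (frac_alg_cst (PN P1)).
apply: frac_algM.
  by apply: frac_alg_cst; rewrite -!(ratr_nat R) -fmorph_div; exact: Pq.
apply: frac_algD; last by apply: AN; exact: frac_algX.
apply: frac_algD; last exact: frac_algX.
apply: frac_algD; last exact: AN.
by apply: frac_algD => //; apply: frac_alg_cst; rewrite -(ratr_nat R) -fmorphV; exact: Pq.
Qed.

End FixedDenominator.

End OneVariable.
End FracAlgebra.

(** * Stability under integration, integrability and rationality *)

Section FracAlgebraIntegral.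
Variables (R : realType) (V : vectType R) (N : seq V) (P : R -> Prop).
Hypotheses (uN : uniq N) (Pq : forall q : rat, P (ratr q)).
Hypotheses (PD : forall x y, P x -> P y -> P (x + y)) (PM : forall x y, P x -> P y -> P (x * y)).
Implicit Types (x : V -> R) (t : R) (a b : V) (F G : (V -> R) -> R).
Local Notation frac_alg := (frac_alg N P).

Let PN y : P y -> P (- y).
Proof. by rewrite -mulN1r -(rmorphN1 (@ratr R)); apply: PM; exact: Pq. Qed.
Let P1 : P 1. Proof. by rewrite -(rmorph1 (@ratr R)); exact: Pq. Qed.
Let PV (n : nat) : P n%:R^-1.
Proof. by rewrite -(ratr_nat R) -fmorphV; exact: Pq. Qed.
Let Pnat n : P n%:R. Proof. by rewrite -(ratr_nat R); exact: Pq. Qed.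

Section Reduction.
Variable a : V.
Hypothesis aN : a \in N.

(** Hermite's identity trades one function of slope [n / Q] for [n] functions of slope [1 / Q]. *)
Let span_pos Q n z0 z : (0 < Q)%N -> (0 < n)%N -> P z0 -> z a = 0 ->
  sawtooth_span N P a Q (fun x t => frac_part (n%:R * (t * Q%:R^-1) + affine N z0 z x)).
Proof.
move=> Q0 n0 Pz za; have nR : n%:R != 0 :> R by rewrite pnatr_eq0 -lt0n.
apply: (@eq_sawtooth_span _ _ _ _ _ _ (fun x t => \sum_(i < n) 1 * sawtooth N Q ((z0 + i%:R)
  / n%:R)
    (fun b => z b / n%:R) x t ^+ 1 - (n%:R - 1) / 2)).
  move=> x t.
  have -> : n%:R * (t * Q%:R^-1) + affine N z0 z x =
    n%:R * (t * Q%:R^-1 + affine N z0 z x / n%:R).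
    by rewrite mulrDr [n%:R * (_ / n%:R)]mulrC divfK.
  rewrite frac_part_mul //; congr (_ - _); apply: eq_bigr => i _.
  rewrite mul1r expr1 /sawtooth; congr frac_part; rewrite -addrA; congr (_ + _).
  have -> : affine N ((z0 + i%:R) / n%:R) (fun b => z b / n%:R) x =
      (z0 + i%:R) / n%:R + (\sum_(b <- N) ratr (z b) * x b) / n%:R.
    rewrite /affine mulr_suml; congr (_ + _); apply: eq_bigr => b _.
    by rewrite fmorph_div rmorph_nat mulrAC.
  by rewrite /affine; ring.
apply: (sawtooth_spanB Pq PM).
  apply: (sawtooth_span_sum Pq) => i; apply: (@sawtooth_span_pow _ _ _ _ _ _ (fun=> 1)) => //.
  - exact: (frac_alg_cst _ P1).
  - by apply: PM => //; apply: PD.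
  - by rewrite za mul0r.
apply: (@sawtooth_span_cst _ _ _ _ Pq _ Q (fun=> (n%:R - 1) / 2)) => //.
by apply: frac_alg_cst; apply: PM => //; apply: PD => //; exact: PN.
Qed.

(* Only almost everywhere, as [{- y} = 1 - {y}] fails at integers. *)
Lemma frac_alg_sawtooth F : frac_alg F -> exists2 Q0 : nat, (0 < Q0)%N &
  forall Q, (0 < Q)%N -> (Q0 %| Q)%N -> exists2 p, sawtooth_span N P a Q p &
  forall x, {ae lebesgue_measure, forall t, F (upd a t x) = p x t}.
Proof.
elim=> [c0 Pc|q0 q Pq0|{}F G _ [Q1 Q10 H1] _ [Q2 Q20 H2]|{}F G _ [Q1 Q10 H1] _ [Q2 Q20 H2]].
- exists 1%N => // Q _ _; exists (fun _ _ => c0); last by move=> x; exact: aeW.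
  by apply: (@sawtooth_span_cst _ _ _ _ Pq _ Q (fun=> c0)) => //; exact: frac_alg_cst.
- exists `|denq (q a)|%N => [|Q Qgt0 /dvdnP[e EQ]]; first by rewrite absz_gt0 denq_neq0.
  have [qa|qa] := eqVneq (q a) 0.
    exists (fun x _ => frac_part (affine N q0 q x)).
      apply: (sawtooth_span_cst Pq Q) => [|t x]; first exact: frac_alg_frac.
      by rewrite affine_indep.
    by move=> x; apply: aeW => t; rewrite affine_indep.
  have QR : Q%:R != 0 :> R by rewrite pnatr_eq0 -lt0n.
  have e0 : (0 < e)%N by move: Qgt0; rewrite EQ muln_gt0 => /andP[].
  pose n := (`|numq (q a)| * e)%N.
  have n0 : (0 < n)%N by rewrite muln_gt0 absz_gt0 numq_eq0 qa.
  have da : zero_at a q a = 0 by rewrite /zero_at eqxx.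
  have Eq : ratr `|q a| = n%:R / Q%:R :> R.
    have eR : e%:R != 0 :> R by rewrite pnatr_eq0 -lt0n.
    have -> : `|q a| = `|numq (q a)|%N%:R / `|denq (q a)|%N%:R.
      by rewrite -{1}(divq_num_den (q a)) normrM normfV !pmulrn !abszE !intr_norm.
    by rewrite fmorph_div !rmorph_nat EQ [(e * _)%N]mulnC /n !natrM -mulf_div divff // mulr1.
  have [qpos|qneg] := ltP 0 (q a).
    exists (fun x t => frac_part (n%:R * (t * Q%:R^-1) + affine N q0 (zero_at a q) x)).
      exact: span_pos.
    move=> x; apply: aeW => t; rewrite affine_upd // -[q a]gtr0_norm // Eq.
    by rewrite mulrAC mulrA.
  exists (fun x t => 1 - frac_part (n%:R * (t * Q%:R^-1) + affine N (- q0) (fun b =>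
    - zero_at a q b) x)).
    apply: (sawtooth_spanB Pq PM).
      by apply: (@sawtooth_span_cst _ _ _ _ Pq _ Q (fun=> 1)) => //; exact: frac_alg_cst.
    by apply: span_pos => //; rewrite ?da ?oppr0 //; exact: PN.
  move=> x; have nQ : n%:R / Q%:R != 0 :> R by rewrite mulf_neq0 ?invr_eq0 // pnatr_eq0 -lt0n.
  have := ae_not_int (affine N (- q0) (fun b => - zero_at a q b) x) nQ.
  apply: (@filterS _ _ (ae_filter_ringOfSetsType _)) => t Ht.
  have EE : n%:R * (t / Q%:R) + affine N (- q0) (fun b => - zero_at a q b) x =
            n%:R / Q%:R * t + affine N (- q0) (fun b => - zero_at a q b) x.
    by rewrite mulrA mulrAC.
  rewrite EE -frac_partN //; congr frac_part; rewrite affine_upd // opprD; congr (_ + _).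
    by rewrite -Eq ler0_norm // rmorphN /= mulNr opprK.
  rewrite /affine opprD opprK; congr (_ + _); rewrite -sumrN; apply: eq_bigr => b _.
  by rewrite rmorphN mulNr opprK.
(* The claim is made for all multiples of a denominator so that two elements can be given a common
   one here. *)
- exists (Q1 * Q2)%N => [|Q Q0 dQ]; first by rewrite muln_gt0 Q10.
  have [p Sp Hp] := H1 _ Q0 (dvdn_trans (dvdn_mulr _ (dvdnn _)) dQ).
  have [p' Sp' Hp'] := H2 _ Q0 (dvdn_trans (dvdn_mull _ (dvdnn _)) dQ).
  exists (fun x t => p x t + p' x t); first exact: sawtooth_spanD.
  by move=> x; apply: ae_imply2 (Hp x) (Hp' x) => t -> ->.
- exists (Q1 * Q2)%N => [|Q Q0 dQ]; first by rewrite muln_gt0 Q10.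
  have [p Sp Hp] := H1 _ Q0 (dvdn_trans (dvdn_mulr _ (dvdnn _)) dQ).
  have [p' Sp' Hp'] := H2 _ Q0 (dvdn_trans (dvdn_mull _ (dvdnn _)) dQ).
  exists (fun x t => p x t * p' x t); first exact: (sawtooth_spanM uN Pq PD PM aN).
  by move=> x; apply: ae_imply2 (Hp x) (Hp' x) => t -> ->.
Qed.

Lemma frac_alg_Rintegral F : frac_alg F ->
  frac_alg (fun x => \int[lebesgue_measure]_(t in `[0, 1]) F (upd a t x)).
Proof.
move=> AF; have [Q Q0 H] := frac_alg_sawtooth AF; have [p Sp Hp] := H Q Q0 (dvdnn Q).
have -> : (fun x => \int[lebesgue_measure]_(t in `[0, 1]) F (upd a t x)) =
    (fun x => \int[lebesgue_measure]_(t in `[0, 1]) p x t).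
  apply/funext => x; apply: ae_Rintegral01 (Hp x).
    exact: frac_alg_measurable AF.
  exact: sawtooth_span_measurable Sp.
exact: (sawtooth_span_integral Pq PD PM Q0 Sp).2.
Qed.

End Reduction.

(** Unlike [iterated_integral], it leaves the coordinates outside [s] free, so that the result is
    again an element of the algebra. *)
Fixpoint partial_integral (s : seq V) F : (V -> R) -> R :=
  if s is a :: s' then fun x =>
    \int[lebesgue_measure]_(t in `[0, 1]) partial_integral s' F (upd a t x)
  else F.

Lemma frac_alg_partial_integral s F : {subset s <= N} -> frac_alg F ->
  frac_alg (partial_integral s F).
Proof.
move=> sN AF; elim: s sN => //= a s IH sN; apply: frac_alg_Rintegral.
  by apply: sN; rewrite mem_head.
by apply: IH => b bs; apply: sN; rewrite in_cons bs orbT.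
Qed.

Lemma partial_integral_upd s F a t x : a \notin s ->
  partial_integral s (F \o upd a t) x = partial_integral s F (upd a t x).
Proof.
elim: s x => //= b s IH x; rewrite in_cons negb_or => /andP[ab as_].
apply: eq_Rintegral => t' _; rewrite IH //; congr (partial_integral s F _).
apply/funext => c; rewrite /upd; case: eqP => // ->; by rewrite (negbTE ab).
Qed.

Lemma iterated_integral_partial s F : uniq s ->
  iterated_integral s F = partial_integral s F (fun=> 0).
Proof.
elim: s F => //= a s IH F /andP[as_ us]; apply: eq_Rintegral => t _.
by rewrite -partial_integral_upd // -IH.
Qed.

End FracAlgebraIntegral.

Lemma frac_alg_iint_ok (R : realType) (V : vectType R) (N s : seq V) F :
  uniq N -> uniq s -> {subset s <= N} -> frac_alg N (fun _ : R => True) F -> iint_ok s F.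
Proof.
move=> uN; elim: s F => //= a s IH F /andP[as_ us] sN AF.
have aN : a \in N by apply: sN; rewrite mem_head.
have sN' : {subset s <= N} by move=> b bs; apply: sN; rewrite in_cons bs orbT.
split=> [t|].
  apply: IH => //; elim: AF => [c0 Pc|q0 q Pq0|{}F G _ AF _ AG|{}F G _ AF _ AG].
  - exact: (frac_alg_cst N (c0 := c0)).
  - rewrite (_ : _ \o _ = (fun x => frac_part (affine N (ratr (q a) * t + q0) (zero_at a q)
    x))); first exact: frac_alg_frac.
    by apply/funext => x; rewrite /= affine_upd // /affine addrA.
  - exact: frac_algD AF AG.
  - exact: frac_algM AF AG.
have -> : (fun t => iterated_integral s (F \o upd a t)) =
   (fun t => partial_integral s F (upd a t (fun=> 0))).
  by apply/funext => t; rewrite iterated_integral_partial // partial_integral_upd.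
by apply: (frac_alg_integrable uN aN (P := fun=> True)); exact: frac_alg_partial_integral.
Qed.

(** The full integral is the value at 0 of an element of the algebra, and there every affine form
    reduces to its rational constant. *)
Lemma frac_alg_rational (R : realType) (V : vectType R) (N : seq V) F :
  uniq N -> frac_alg N (fun y : R => exists q, y = ratr q) F ->
  exists q, iterated_integral N F = ratr q.
Proof.
move=> uN; set P := (fun y : R => _) => AF; rewrite iterated_integral_partial //.
have PD y y' : P y -> P y' -> P (y + y').
  by move=> [q ->] [q' ->]; exists (q + q'); rewrite rmorphD.
have PM y y' : P y -> P y' -> P (y * y').
  by move=> [q ->] [q' ->]; exists (q * q'); rewrite rmorphM.
have Pq q : P (ratr q) by exists q.
have := frac_alg_partial_integral uN Pq PD PM (fun _ => id) AF.
elim=> [//|_ q' [q ->]|F1 F2 _ + _|F1 F2 _ + _]; [|exact: PD|exact: PM].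
rewrite /affine big1 ?addr0 => [|b _]; last by rewrite mulr0.
have -> : ratr q = (Num.floor q)%:~R + ratr (q - (Num.floor q)%:~R) :> R.
  by rewrite rmorphB /= ratr_int addrC subrK.
rewrite frac_part_eq; first exact: Pq.
rewrite ler0q subr_ge0 floor_le /=.
by rewrite -(rmorph1 (@ratr R)) ltr_rat ltrBlDl -intrD1 floorD1_gt.
Qed.

(** * Root systems *)

Lemma exists_min_seq (T : eqType) (R : realDomainType) (s : seq T) (f : T -> R) x :
  x \in s -> exists2 y, y \in s & forall z, z \in s -> f y <= f z.
Proof.
elim: s x => // a s IH x _; case: s IH => [|b s] IH.
  by exists a; rewrite ?mem_head // => z; rewrite inE => /eqP->.
have [|y ys Hy] := IH b; first by rewrite mem_head.
have [ay|ya] := leP (f a) (f y).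
  exists a; first by rewrite mem_head.
  by move=> z; rewrite in_cons => /predU1P[->//|/Hy]; exact: le_trans.
exists y; first by rewrite in_cons ys orbT.
by move=> z; rewrite in_cons => /predU1P[->|/Hy//]; exact: ltW.
Qed.

Section InnerProduct.
Variables (R : realType) (V : vectType R) (ip : {dot V for @idfun R}).
Implicit Types (a b u v w : V).

Lemma ipC u v : ip u v = ip v u.
Proof. by rewrite hermC expr0 mul1r. Qed.

Lemma ipDr u v w : ip u (v + w) = ip u v + ip u w. Proof. exact: linearDr. Qed.
Lemma ipDl u v w : ip (u + v) w = ip u w + ip v w. Proof. by rewrite !(ipC _ w) ipDr. Qed.
Lemma ipZr c u v : ip u (c *: v) = c * ip u v. Proof. exact: linearZr. Qed.
Lemma ipZl c u v : ip (c *: u) v = c * ip u v. Proof. by rewrite ipC ipZr ipC. Qed.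
Lemma ipNr u v : ip u (- v) = - ip u v. Proof. by rewrite -scaleN1r ipZr mulN1r. Qed.
Lemma ipNl u v : ip (- u) v = - ip u v. Proof. by rewrite ipC ipNr ipC. Qed.
Lemma ipBr u v w : ip u (v - w) = ip u v - ip u w. Proof. by rewrite ipDr ipNr. Qed.
Lemma ipBl u v w : ip (u - v) w = ip u w - ip v w. Proof. by rewrite ipDl ipNl. Qed.
Lemma ip0r u : ip u 0 = 0. Proof. by rewrite -(scale0r 0) ipZr mul0r. Qed.
Lemma ip_sumr (I : Type) (s : seq I) (F : I -> V) u :
  ip u (\sum_(i <- s) F i) = \sum_(i <- s) ip u (F i).
Proof. by elim/big_rec2: _ => [|i x y _ <-]; rewrite ?ip0r // ipDr. Qed.
Lemma ip_suml (I : Type) (s : seq I) (F : I -> V) u :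
  ip (\sum_(i <- s) F i) u = \sum_(i <- s) ip (F i) u.
Proof. by rewrite ipC ip_sumr; apply: eq_bigr => i _; rewrite ipC. Qed.

Lemma ip_gt0 u : u != 0 -> 0 < ip u u. Proof. exact: neq0_dnorm_gt0. Qed.
End InnerProduct.

HB.instance Definition _ (R : realType) (V : vectType R) (ip : {dot V for @idfun R}) (a : V) :=
  GRing.isLinear.Build R V V *:%R (reflection ip a) (reflection_is_linear ip a).

Section Roots.
Variables (R : realType) (V : vectType R) (ip : {dot V for @idfun R}).
Variables (r : nat) (Delta : {fset V}) (Psi lambda : r.-tuple V).
Hypotheses (root_Delta : root_system ip Delta) (fund_Psi : fundamental_system Delta Psi).
Hypothesis (fund_lambda : fundamental_weights ip Psi lambda).
Implicit Types (a b u v w : V) (i j : 'I_r) (s : seq 'I_r).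

Local Notation alpha := (tnth Psi).
Local Notation coroot := (coroot ip).
Local Notation reflection := (reflection ip).
Local Notation pos := (nonneg_comb Psi).

Lemma root_neq0 a : a \in Delta -> a != 0.
Proof. by case: root_Delta => _ D0 _ _ _; apply: contraTneq => ->. Qed.

Lemma root_sqr_gt0 a : a \in Delta -> 0 < ip a a.
Proof. by move=> /root_neq0; exact: ip_gt0. Qed.

Lemma corootE a v : ip (coroot a) v = 2 / ip a a * ip a v.
Proof. exact: ipZl. Qed.

Lemma alphaD i : alpha i \in Delta.
Proof. by case: fund_Psi => _ + _; apply; exact: mem_tnth. Qed.

Lemma alpha_basis : basis_of fullv Psi. Proof. by case: fund_Psi. Qed.

Lemma coroot_alpha i : ip (coroot (alpha i)) (alpha i) = 2.
Proof. by rewrite corootE divfK // gt_eqF // root_sqr_gt0 ?alphaD. Qed.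

Lemma reflection_root a : a \in Delta -> reflection a a = - a.
Proof.
move=> aD; rewrite /Defs.reflection corootE divfK ?gt_eqF ?root_sqr_gt0 //.
by rewrite scaler_nat mulr2n opprD addNKr.
Qed.

Lemma reflectionD a b : a \in Delta -> b \in Delta -> reflection a b \in Delta.
Proof. by case: root_Delta => _ _ + _ _; apply. Qed.

Lemma oppD a : a \in Delta -> - a \in Delta.
Proof. by move=> aD; rewrite -reflection_root // reflectionD. Qed.

Lemma corootN a : coroot (- a) = - coroot a.
Proof. by rewrite /Defs.coroot ipNl ipNr opprK scalerN. Qed.

Lemma reflectionN a v : reflection (- a) v = reflection a v.
Proof. by rewrite /Defs.reflection corootN ipNl scaleNr scalerN opprK. Qed.

Lemma reflectionK a : a \in Delta -> involutive (reflection a).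
Proof.
move=> aD v; rewrite /Defs.reflection ipBr ipZr !corootE divfK ?gt_eqF ?root_sqr_gt0 //.
by rewrite mulr_natr mulr2n opprD addNKr scaleNr opprK subrK.
Qed.

Lemma ip_reflection a u v : a \in Delta -> ip (reflection a u) (reflection a v) = ip u v.
Proof.
move=> aD; have a0 := root_sqr_gt0 aD.
rewrite /Defs.reflection ipBl !ipBr !ipZl !ipZr (ipC _ u a).
by field; rewrite gt_eqF.
Qed.

Lemma reflection_linear a : linear (reflection a). Proof. exact: reflection_is_linear. Qed.
Lemma reflectionZ a c v : reflection a (c *: v) = c *: reflection a v.
Proof. by rewrite /Defs.reflection ipZr scalerBr scalerA. Qed.

Lemma coroot_reflection a b : a \in Delta -> coroot (reflection a b) = reflection a (coroot b).
Proof. by move=> aD; rewrite /Defs.coroot ip_reflection // reflectionZ. Qed.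

Lemma ip_alpha_lambda i j : ip (alpha i) (tnth lambda j) = (i ==
  j)%:R * (ip (alpha i) (alpha i) / 2).
Proof.
have a0 := root_sqr_gt0 (alphaD i); rewrite -fund_lambda corootE; field.
by rewrite gt_eqF.
Qed.

Lemma ip_comb_lambda (m : 'I_r -> nat) j :
  ip (\sum_i alpha i *+ m i) (tnth lambda j) = (m j)%:R * (ip (alpha j) (alpha j) / 2).
Proof.
rewrite ip_suml (bigD1 j) //= big1 ?addr0 => [|i ij].
  by rewrite -scaler_nat ipZl ip_alpha_lambda eqxx mul1r.
by rewrite -scaler_nat ipZl ip_alpha_lambda (negbTE ij) mul0r mulr0.
Qed.

Lemma half_sqr_gt0 i : 0 < ip (alpha i) (alpha i) / 2.
Proof. by rewrite divr_gt0 ?root_sqr_gt0 ?alphaD. Qed.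

Lemma pos_lambda_ge0 a i : pos a -> 0 <= ip a (tnth lambda i).
Proof. by move=> [m ->]; rewrite ip_comb_lambda mulr_ge0 // ltW ?half_sqr_gt0. Qed.

(** The open fundamental chamber: strict inequalities exclude the walls. *)
Definition dominant v := forall i, 0 < ip (coroot (alpha i)) v.

Lemma dominantE v : dominant v <-> forall i, 0 < ip (alpha i) v.
Proof.
have H i : (0 < ip (coroot (alpha i)) v) = (0 < ip (alpha i) v).
  by rewrite corootE pmulr_rgt0 // divr_gt0 ?root_sqr_gt0 ?alphaD.
by split=> Hv i; have := Hv i; rewrite H.
Qed.

Lemma pos_dominant a v : a != 0 -> pos a -> dominant v -> 0 < ip a v.
Proof.
move=> + [m Em] /dominantE dv; rewrite {1}Em => a0; rewrite Em ip_suml.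
have term_ge0 i : 0 <= ip (alpha i *+ m i) v.
  by rewrite -scaler_nat ipZl mulr_ge0 // ltW.
rewrite lt_neqAle sumr_ge0 ?andbT // eq_sym; apply: contra a0.
rewrite psumr_eq0 // => /allP H; rewrite big1 // => i _.
have /implyP/(_ isT) := H i (mem_index_enum _).
by rewrite -scaler_nat ipZl mulf_eq0 (gt_eqF (dv i)) orbF pnatr_eq0 => /eqP->; rewrite scale0r.
Qed.

Lemma pos_or_neg a : a \in Delta -> pos a \/ pos (- a).
Proof. by case: fund_Psi => _ _; apply. Qed.

Lemma pos_iff a v : a \in Delta -> dominant v -> pos a <-> 0 < ip a v.
Proof.
move=> aD dv; split=> [pa|av]; first exact: pos_dominant (root_neq0 aD) pa dv.
have [//|na] := pos_or_neg aD; have := pos_dominant (root_neq0 (oppD aD)) na dv.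
by rewrite ipNl oppr_gt0 ltNge ltW.
Qed.

(** Serves as a vector inside the chamber: the sign of the pairing with it tells positive roots from
    negative ones, and its pairing is the quantity minimised or maximised along orbits. *)
Definition rho : V := \sum_i tnth lambda i.

Lemma dominant_rho : dominant rho.
Proof.
move=> i; rewrite ip_sumr (bigD1 i) //= big1 ?addr0 => [|j ji].
  by rewrite fund_lambda eqxx.
by rewrite fund_lambda eq_sym (negbTE ji).
Qed.

Lemma not_pos_neg a : a \in Delta -> pos a -> pos (- a) -> False.
Proof.
move=> aD /(pos_iff aD dominant_rho) p /(pos_iff (oppD aD) dominant_rho).
by rewrite ipNl oppr_gt0 ltNge ltW.
Qed.

Lemma pos_alpha i : pos (alpha i).
Proof.
exists (fun j => (i == j) : nat); rewrite (bigD1 i) //= eqxx mulr1n big1 ?addr0 // => j ji.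
by rewrite eq_sym (negbTE ji) mulr0n.
Qed.

(** The reflection changes only the coordinate along [alpha i]. If the image were negative, all
    other coordinates of [a] would vanish; then [a] is a nonnegative multiple of [alpha i], hence
    equal to it as the system is reduced. *)
Lemma reflection_alpha_pos i a : a \in Delta -> pos a -> a != alpha i ->
  pos (reflection (alpha i) a).
Proof.
move=> aD pa ai; have sD := reflectionD (alphaD i) aD.
have [//|ns] := pos_or_neg sD.
have sl j : j != i -> ip (reflection (alpha i) a) (tnth lambda j) = ip a (tnth lambda j).
  by move=> ji; rewrite /Defs.reflection ipBl ipZl ip_alpha_lambda eq_sym (negbTE ji) mul0r
    mulr0 subr0.
have al j : j != i -> ip a (tnth lambda j) = 0.
  move=> ji; apply/eqP; rewrite eq_le pos_lambda_ge0 // andbT -sl //.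
  by rewrite -oppr_ge0 -ipNl pos_lambda_ge0.
have [m Em] := pa.
have m0 j : j != i -> m j = 0%N.
  move=> /al; rewrite Em ip_comb_lambda => /eqP; rewrite mulf_eq0 (gt_eqF (half_sqr_gt0 j)) orbF.
  by rewrite pnatr_eq0 => /eqP.
have Ea : a = (m i)%:R *: alpha i.
  rewrite {1}Em (bigD1 i) //= big1 ?addr0 ?scaler_nat // => j ji.
  by rewrite m0 // mulr0n.
case: root_Delta => _ _ _ _ /(_ (alpha i) (m i)%:R (alphaD i)); rewrite -Ea => /(_ aD) [] E.
  by move: ai; rewrite Ea E scale1r eqxx.
by have := ler0n R (m i); rewrite E lerNr oppr0 ler10.
Qed.

(** Words in the simple reflections stand for elements of the Weyl group; their length is what the
    induction for simple transitivity runs on. *)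
Definition wact s v : V := foldr (fun i => reflection (alpha i)) v s.

Lemma wact_cat s1 s2 v : wact (s1 ++ s2) v = wact s1 (wact s2 v).
Proof. exact: foldr_cat. Qed.

Lemma wact_rcons s i v : wact (rcons s i) v = wact s (reflection (alpha i) v).
Proof. by rewrite -cats1 wact_cat. Qed.

Lemma wactD s a : a \in Delta -> wact s a \in Delta.
Proof. by move=> aD; elim: s => //= i s IH; rewrite reflectionD ?alphaD. Qed.

Lemma wact_linear s : linear (wact s).
Proof. by elim: s => [//|i s IH] c u v /=; rewrite IH reflection_linear. Qed.

Lemma wactZ s c v : wact s (c *: v) = c *: wact s v.
Proof. by elim: s => //= i s ->; rewrite reflectionZ. Qed.

Lemma wactN s v : wact s (- v) = - wact s v.
Proof. by rewrite -scaleN1r wactZ scaleN1r. Qed.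

Lemma ip_wact s u v : ip (wact s u) (wact s v) = ip u v.
Proof. by elim: s => //= i s IH; rewrite ip_reflection ?alphaD. Qed.

Lemma coroot_wact s a : coroot (wact s a) = wact s (coroot a).
Proof. by rewrite /Defs.coroot ip_wact wactZ. Qed.

Lemma wact_revK s : cancel (wact s) (wact (rev s)).
Proof.
elim: s => // i s IH v; rewrite rev_cons wact_rcons /= reflectionK ?alphaD //.
Qed.

Lemma wact_revKV s : cancel (wact (rev s)) (wact s).
Proof. by move=> v; have := wact_revK (rev s) v; rewrite revK. Qed.

Lemma reflection_wact s i v :
  reflection (wact s (alpha i)) (wact s v) = wact s (reflection (alpha i) v).
Proof.
have -> : reflection (alpha i) v = (- ip (coroot (alpha i)) v) *: alpha i + v.
  by rewrite scaleNr addrC.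
by rewrite wact_linear /Defs.reflection coroot_wact ip_wact scaleNr addrC.
Qed.

(** Among the positive roots in the orbit of [a], one with minimal pairing with [rho] is simple:
    otherwise some simple reflection would lower the pairing and keep the root positive. *)
Lemma pos_root_conj a : a \in Delta -> pos a -> exists s i, a = wact s (alpha i).
Proof.
move=> aD pa.
pose Q b := `[< pos b /\ exists s, b = wact s a >].
have aS : a \in [seq b <- Delta | Q b].
  by rewrite mem_filter aD andbT; apply/asboolP; split => //; exists [::].
have [b] := exists_min_seq (fun b => ip b rho) aS.
rewrite mem_filter => /andP[/asboolP[pb [s Eb]] bD] bmin.
have [[i Ei]|nsimple] := pselect (exists i, b = alpha i).
  by exists (rev s), i; rewrite -Ei Eb wact_revK.
exfalso.
  (* [<b, b>] is positive and is a nonnegative combination of the [<alpha_i, b>]. *)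
  have [i ib] : exists i, 0 < ip (alpha i) b.
    apply: contrapT => /forallNP H; have := root_sqr_gt0 bD; have [m Em] := pb.
    rewrite {1}Em ip_suml ltNge; apply/negP/negPn/sumr_le0 => i _.
    by rewrite -scaler_nat ipZl mulr_ge0_le0 // leNgt; apply/negP/H.
  have bi : b != alpha i by apply/eqP => E; apply: nsimple; exists i.
  have sS : reflection (alpha i) b \in [seq b <- Delta | Q b].
    rewrite mem_filter reflectionD ?alphaD // andbT; apply/asboolP; split.
      exact: reflection_alpha_pos.
    by exists (i :: s); rewrite Eb.
  have := bmin _ sS; rewrite /= /Defs.reflection ipBl ipZl lerBrDl gerDr leNgt.
  have ri := (dominantE rho).1 dominant_rho i.
  by rewrite corootE mulr_gt0 // mulr_gt0 // divr_gt0 // root_sqr_gt0 // alphaD.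
Qed.

(* If [wact s] makes [alpha j] negative, some letter of [s] cancels against [j]. *)
Lemma wact_deletion s j : pos (- wact s (alpha j)) ->
  exists2 s', size s = (size s').+1 & forall v, wact s (reflection (alpha j) v) = wact s' v.
Proof.
elim: s => [|i s IH] /= neg.
  by case: (not_pos_neg (alphaD j) (pos_alpha j) neg).
have bD := wactD s (alphaD j).
have [pb|nb] := pos_or_neg bD; last first.
  by have [s' sz E] := IH nb; exists (i :: s') => [|v] /=; rewrite ?sz ?E.
have Eb : wact s (alpha j) = alpha i.
  apply/eqP; apply: contraT => bi.
  by case: (not_pos_neg (reflectionD (alphaD i) bD) (reflection_alpha_pos bD pb bi) neg).
exists s => // v; rewrite -reflection_wact Eb reflectionK //; exact: alphaD.
Qed.

(** If the word [rcons s j] keeps [alpha j] positive, then [s] makes it negative, and the deletion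
    property gives a word with the same action and two letters fewer. *)
Lemma wact_id s : (forall i, pos (wact s (alpha i))) -> wact s =1 id.
Proof.
have [n] := ubnP (size s); elim: n s => // n IH s; case/lastP: s => [//|s j].
rewrite size_rcons !ltnS => sn Hpos v.
have neg : pos (- wact s (alpha j)).
  by have := Hpos j; rewrite wact_rcons reflection_root ?alphaD // wactN.
have [s' sz E] := wact_deletion neg.
rewrite wact_rcons E; apply: IH; first by rewrite sz in sn; exact: ltn_trans sn.
by move=> i; have := Hpos i; rewrite wact_rcons E.
Qed.

(** The isometry preserves [<alpha_i, v> > 0], so the images of the simple roots pair positively
    with the dominant vector [wact s v] and are positive roots. *)
Lemma dominant_unique s v : dominant v -> dominant (wact s v) -> wact s =1 id.
Proof.
move=> dv dsv; apply: wact_id => i; apply/(pos_iff (wactD s (alphaD i)) dsv).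
by rewrite ip_wact; exact: (dominantE v).1.
Qed.

Lemma eq_lfun_alpha (f g : 'End(V)) : (forall i, f (alpha i) = g (alpha i)) -> f = g.
Proof.
move=> fg; apply/lfunP => v; rewrite (coord_basis alpha_basis (memvf v)) !linear_sum.
by apply: eq_bigr => i _; rewrite !linearZ /= -tnth_nth fg.
Qed.

Lemma weight_expansion v : v = \sum_i ip (coroot (alpha i)) v *: tnth lambda i.
Proof.
set w := \sum_i _; apply/eqP; rewrite -subr_eq0; apply: contraT => /(ip_gt0 ip).
have orth i : ip (alpha i) (v - w) = 0.
  have : ip (coroot (alpha i)) (v - w) = 0.
    rewrite ipBr ip_sumr (bigD1 i) //= big1 ?addr0 => [|j ji].
      by rewrite ipZr fund_lambda eqxx mulr1 subrr.
    by rewrite ipZr fund_lambda eq_sym (negbTE ji) mulr0.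
  move/eqP; rewrite corootE mulf_eq0 => /orP[|/eqP//].
  by rewrite gt_eqF // divr_gt0 // root_sqr_gt0 // alphaD.
rewrite {1}(coord_basis alpha_basis (memvf (v - w))) ip_suml big1 ?ltxx // => i _.
by rewrite ipZl -tnth_nth orth mulr0.
Qed.

(** Up to sign a root is [w alpha_i] for a word [w], and its reflection is then the conjugate
    [w s_i w^-1], again a word. *)
Lemma weyl_wact (f : 'End(V)) : weyl_group ip Delta f -> exists s, forall v, f v = wact s v.
Proof.
elim=> [|a g aD _ [s Es]]; first by exists [::] => v; rewrite id_lfunE.
have [s' Es'] : exists s', forall v, reflection a v = wact s' v.
  have [b [pb bD Eb]] : exists b, [/\ pos b, b \in Delta & forall v, reflection a v =
    reflection b v].
    have [pa|na] := pos_or_neg aD; first by exists a.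
    by exists (- a); split=> // [|v]; [exact: oppD | rewrite reflectionN].
  have [s' [i Ei]] := pos_root_conj bD pb; exists (s' ++ i :: rev s') => v.
  by rewrite Eb Ei wact_cat -{1}(wact_revKV s' v) reflection_wact.
by exists (s' ++ s) => v; rewrite comp_lfunE lfunE /= Es Es' wact_cat.
Qed.

Lemma wact_weyl s : exists2 f : 'End(V), weyl_group ip Delta f & forall v, f v = wact s v.
Proof.
elim: s => [|i s [f Wf Ef]]; first by exists \1%VF => [|v]; [exact: weyl_id | rewrite id_lfunE].
exists (linfun (reflection (alpha i)) \o f)%VF => [|v];
  first exact: weyl_reflection (alphaD i) Wf.
by rewrite comp_lfunE lfunE /= Ef.
Qed.

Lemma weyl_finite : finite_set (weyl_group ip Delta).
Proof.
(* A Weyl group element is determined by the images of the simple roots, which lie in the finite set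
   of roots. *)
pose h (f : 'End(V)) := [ffun i : 'I_r => insub (f (alpha i)) : option Delta].
rewrite -(eq_finite_set (inj_card_eq (f := h) _)); first exact: finite_finset.
move=> f g /set_mem /weyl_wact[s Es] /set_mem /weyl_wact[s' Es'] hfg.
apply: eq_lfun_alpha => i; have := congr1 (fun k : {ffun _} => k i) hfg; rewrite !ffunE.
rewrite Es Es' !insubT ?wactD ?alphaD // => sD s'D /Some_inj.
by move=> /(congr1 val).
Qed.

Local Notation W := (fset_set (weyl_group ip Delta)).

Lemma mem_weyl_fset (f : 'End(V)) : (f \in W) = `[< weyl_group ip Delta f >].
Proof. by rewrite in_fset_set //; exact: weyl_finite. Qed.

(** A conjugate with maximal pairing with [rho] is dominant, since reflecting across a wall with
    [<alpha_i, b> < 0] would increase the pairing. The maximum exists because the orbit stays in the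
    finite stable set [X]. *)
Lemma dominant_conj (X : {fset V}) v : (forall i u, u \in X -> reflection (alpha i) u \in X) ->
  v \in X -> (forall a, a \in Delta -> ip a v != 0) -> exists s, dominant (wact s v).
Proof.
move=> stX vX reg; pose Q b := `[< exists s, b = wact s v >].
have vS : v \in [seq b <- X | Q b] by rewrite mem_filter vX andbT; apply/asboolP; exists [::].
have [b] := exists_min_seq (fun b => - ip b rho) vS.
rewrite mem_filter => /andP[/asboolP[s Eb] bX] bmin; exists s; rewrite -Eb; apply/dominantE => i.
have : ip (alpha i) b != 0.
  by rewrite -(ip_wact (rev s)) Eb wact_revK reg // wactD // alphaD.
rewrite neq_lt => /orP[bi|//].
have sS : reflection (alpha i) b \in [seq b <- X | Q b].
  by rewrite mem_filter stX // andbT; apply/asboolP; exists (i :: s); rewrite Eb.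
have := bmin _ sS; rewrite lerN2 /Defs.reflection ipBl ipZl gerBl leNgt.
have ri := (dominantE rho).1 dominant_rho i.
rewrite pmulr_llt0 // corootE pmulr_rlt0 ?bi //.
by rewrite divr_gt0 // root_sqr_gt0 // alphaD.
Qed.

(** Double counting of the pairs of [g] in the group and [v] in [X] with [g v] dominant: a regular
    [v] has exactly one such [g], the others contribute 0, and each [g] permutes [X] and preserves
    [f]. *)
Lemma weyl_sum (X : {fset V}) (f : V -> R) :
  (forall i u, u \in X -> reflection (alpha i) u \in X) ->
  (forall i u, f (reflection (alpha i) u) = f u) ->
  (forall u a, a \in Delta -> ip a u = 0 -> f u = 0) ->
  \sum_(v <- X) f v = (weyl_order ip Delta)%:R * \sum_(v <- X | `[< dominant v >]) f v.
Proof.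
move=> stX f_inv f_irr.
have wX s v : v \in X -> wact s v \in X.
  by move=> vX; elim: s => //= i s IH; exact: stX.
have f_wact s v : f (wact s v) = f v by elim: s => //= i s IH; rewrite f_inv.
have one v : v \in X -> f v = \sum_(g <- W) (`[< dominant (g v) >])%:R * f v.
  move=> vX; have [[a [aD av]]|reg] := pselect (exists a, a \in Delta /\ ip a v = 0).
    by rewrite (f_irr _ _ aD av) big1 // => g _; rewrite mulr0.
  have [a aD|s dsv] := dominant_conj stX vX; first by apply/eqP => av; apply: reg; exists a.
  have [g Wg Eg] := wact_weyl s.
  have gW : g \in W by rewrite mem_weyl_fset; apply/asboolP.
  have dg : `[< dominant (g v) >] by apply/asboolP; rewrite Eg.
  rewrite (bigD1_seq g gW (fset_uniq W)) /= dg mul1r big_seq_cond big1 ?addr0 // => g' /andP[].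
  rewrite mem_weyl_fset => /asboolP/weyl_wact[s' Es'] g'g; case: asboolP => [dg'|];
    last by rewrite mul0r.
  case/eqP: g'g; apply/lfunP => u; rewrite Eg Es'.
  (* This word represents [g' g^-1], which carries the dominant vector [g v] to the dominant vector
     [g' v]. *)
  have := @dominant_unique (s' ++ rev s) _ dsv; rewrite wact_cat wact_revK -Es' =>
    /(_ dg' (wact s u)).
  by rewrite wact_cat wact_revK.
rewrite big_seq (eq_bigr _ one) -big_seq exchange_big /=.
have each g : g \in W -> \sum_(v <- X) (`[< dominant (g v) >])%:R * f v =
  \sum_(v <- X | `[< dominant v >]) f v.
  rewrite mem_weyl_fset => /asboolP/weyl_wact[s Es].
  rewrite [RHS]big_mkcond /=.
  have pX : perm_eq X (map (wact s) X).
    apply: uniq_perm; first exact: fset_uniq.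
      by rewrite (map_inj_uniq (can_inj (wact_revK s))) fset_uniq.
    move=> v; apply/idP/mapP => [vX|[u uX ->]]; last exact: wX.
    by exists (wact (rev s) v); [exact: wX | rewrite wact_revKV].
  rewrite [RHS](perm_big _ pX) big_map; apply: eq_bigr => v _; rewrite Es f_wact;
    case: asboolP => _.
    by rewrite mul1r.
  by rewrite mul0r.
rewrite big_seq (eq_bigr _ each) -big_seq big_const_seq count_predT iter_addr_0.
by rewrite mulr_natl.
Qed.

(** Integrality propagates along words from the simple coroots: a simple reflection changes a
    coroot's pairing with [lambda_i] by a Cartan integer times 0 or 1. *)
Lemma coroot_lambda_int a i : a \in Delta -> ip (coroot a) (tnth lambda i) \is a Num.int.
Proof.
wlog pa : a / pos a => [H aD|].
  have [pa|na] := pos_or_neg aD; first exact: H.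
  by rewrite -[a]opprK corootN ipNl rpredN; apply: H => //; exact: oppD.
move=> aD; have [s [j ->]] := pos_root_conj aD pa.
elim: s => [|k s IH] /=; first by rewrite fund_lambda; exact: natr_int.
rewrite coroot_reflection ?alphaD // {1}/Defs.reflection ipBl rpredB //.
have -> : ip (ip (coroot (alpha k)) (coroot (wact s (alpha j))) *: alpha k) (tnth lambda i) =
   ip (coroot (wact s (alpha j))) (alpha k) * ip (coroot (alpha k)) (tnth lambda i).
  by rewrite ipZl !corootE (ipC _ (alpha k)) corootE; ring.
apply: rpredM; last by rewrite fund_lambda; exact: natr_int.
by case: root_Delta => _ _ _ + _; apply; [rewrite wactD ?alphaD | exact: alphaD].
Qed.

(** * Sums over the weight lattice and the zeta value *)

Section Zeta.
Variable k : V -> nat.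
Hypotheses (k_gt0 : forall a, a \in Delta -> (0 < k a)%N).
Hypothesis k_reflection : forall a b, a \in Delta -> b \in Delta -> k (reflection a b) = k b.

Local Notation Dplus := (positive_roots Delta Psi).
Local Notation N := (nonsimple_roots Delta Psi).

Lemma mem_Dplus a : reflect (a \in Delta /\ pos a) (a \in Dplus).
Proof.
rewrite !inE /=; apply: (iffP andP) => [[-> /asboolP]//|[-> pa]].
by split => //; apply/asboolP.
Qed.

Lemma alpha_Dplus i : alpha i \in Dplus.
Proof. by apply/mem_Dplus; split; [exact: alphaD | exact: pos_alpha]. Qed.

Lemma mem_nonsimple a : (a \in N) = (a \in Dplus) && (a \notin Psi).
Proof. by rewrite !inE. Qed.

Lemma perm_Dplus : perm_eq Dplus (N ++ Psi).
Proof.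
apply: uniq_perm; first exact: fset_uniq.
  rewrite cat_uniq fset_uniq (free_uniq (basis_free alpha_basis)) /= andbT.
  by apply/hasPn => a aP; rewrite mem_nonsimple aP andbF.
move=> a; rewrite mem_cat mem_nonsimple; case aP: (a \in val Psi); rewrite ?andbT ?orbF // orbT.
by have /tnthP[i ->] := aP; exact: alpha_Dplus.
Qed.

Lemma big_Dplus (S : comSemiRingType) (F : V -> S) :
  \prod_(a <- Dplus) F a = (\prod_(a <- N) F a) * \prod_i F (alpha i).
Proof. by rewrite (perm_big _ perm_Dplus) big_cat /= big_tuple. Qed.

(* Vanishes at irregular [v], as [0^-1 = 0]. *)
Definition weight_term v : R := \prod_(a <- Dplus) ip (coroot a) v ^- (2 * k a).

Lemma weight_term_ge0 v : 0 <= weight_term v.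
Proof. by apply: prodr_ge0 => a _; rewrite invr_ge0 exprM exprn_ge0 // sqr_ge0. Qed.

Lemma weight_term_reflection i v : weight_term (reflection (alpha i) v) = weight_term v.
Proof.
(* The permutation of the positive roots induced by the simple reflection up to sign: only [alpha i]
   would become negative, and the even exponent forgives the sign. *)
pose tau a := if a == alpha i then a else reflection (alpha i) a.
have tauD a : a \in Dplus -> tau a \in Dplus.
  move=> aDp; rewrite /tau; case: eqP => // /eqP ai; move/mem_Dplus: aDp => [aD pa].
  by apply/mem_Dplus; rewrite reflectionD ?alphaD //; split => //; exact: reflection_alpha_pos.
have tauK : {in Dplus, involutive tau}.
  move=> a aDp; rewrite /tau; case: (eqVneq a (alpha i)) => [->|ai]; first by rewrite eqxx.
  case: eqP => [E|_]; last by rewrite reflectionK ?alphaD.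
  have [aD pa] := mem_Dplus _ aDp.
  have Ea : a = - alpha i by rewrite -(reflectionK (alphaD i) a) E reflection_root ?alphaD.
  by case: (not_pos_neg (alphaD i) (pos_alpha i)); rewrite -Ea.
have perm_tau : perm_eq Dplus (map tau Dplus).
  apply: uniq_perm; first exact: fset_uniq.
    by rewrite map_inj_in_uniq ?fset_uniq // => a b aD bD /(congr1 tau); rewrite !tauK.
  move=> a; apply/idP/mapP => [aD|[b bD ->]]; last exact: tauD.
  by exists (tau a); rewrite ?tauD ?tauK.
rewrite /weight_term [RHS](perm_big _ perm_tau) big_map; apply: eq_big_seq => a /mem_Dplus[aD _].
rewrite /tau; case: eqP => [->|_].
  have -> : ip (coroot (alpha i)) (reflection (alpha i) v) = - ip (coroot (alpha i)) v.
    by rewrite /Defs.reflection ipBr ipZr coroot_alpha; ring.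
  by rewrite !exprM sqrrN.
rewrite coroot_reflection ?alphaD // k_reflection ?alphaD //.
by rewrite -{1}(reflectionK (alphaD i) (coroot a)) ip_reflection ?alphaD.
Qed.

Lemma weight_term_irregular v a : a \in Delta -> ip a v = 0 -> weight_term v = 0.
Proof.
have main b : b \in Dplus -> ip b v = 0 -> weight_term v = 0.
  move=> bD bv; apply/eqP; rewrite prodf_seq_eq0; apply/hasP; exists b => //=.
  rewrite corootE bv mulr0 expr0n muln_eq0 /= gtn_eqF ?invr0 //.
  by have [/k_gt0] := mem_Dplus _ bD.
move=> aD av; have [pa|na] := pos_or_neg aD; first by apply: (main a) => //; apply/mem_Dplus.
apply: (main (- a)); first by apply/mem_Dplus; split => //; exact: oppD.
by rewrite ipNl av oppr0.
Qed.

Definition coroot_coef a i : int := Num.floor (ip (coroot a) (tnth lambda i)).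

Lemma coroot_coefE a i : a \in Delta -> ip (coroot a) (tnth lambda i) = (coroot_coef a i)%:~R.
Proof. by move=> /(coroot_lambda_int i) /floorK. Qed.

Definition weight (n : 'I_r -> int) : V := \sum_i (n i)%:~R *: tnth lambda i.

Lemma ip_coroot_weight a n : a \in Delta ->
  ip (coroot a) (weight n) = (\sum_i n i * coroot_coef a i)%:~R.
Proof.
move=> aD; rewrite ip_sumr rmorph_sum; apply: eq_bigr => i _.
by rewrite ipZr coroot_coefE // rmorphM.
Qed.

Lemma ip_coroot_alpha_weight i n : ip (coroot (alpha i)) (weight n) = (n i)%:~R.
Proof.
rewrite ip_sumr (bigD1 i) //= big1 ?addr0 => [|j ji].
  by rewrite ipZr fund_lambda eqxx mulr1.
by rewrite ipZr fund_lambda eq_sym (negbTE ji) mulr0.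
Qed.

Lemma weight_inj n n' : weight n = weight n' -> n =1 n'.
Proof.
move=> E i; have := congr1 (ip (coroot (alpha i))) E.
by rewrite !ip_coroot_alpha_weight => /intr_inj.
Qed.

Definition weight_lattice v := forall i, ip (coroot (alpha i)) v \is a Num.int.

Lemma weight_latticeE v : weight_lattice v ->
  v = weight (fun i => Num.floor (ip (coroot (alpha i)) v)).
Proof.
by move=> Lv; rewrite {1}[v]weight_expansion; apply: eq_bigr => i _; rewrite floorK.
Qed.

Lemma weight_lattice_root a v : weight_lattice v -> a \in Delta -> ip (coroot a) v \is a Num.int.
Proof. by move=> /weight_latticeE -> aD; rewrite ip_coroot_weight. Qed.

Lemma regular_dominant_weightsE v :
  regular_dominant_weights lambda v <-> weight_lattice v /\ dominant v.
Proof.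
have sumE (m : 'I_r -> nat) : \sum_i tnth lambda i *+ m i = weight (fun i => (m i)%:Z).
  by apply: eq_bigr => i _; rewrite scaler_nat.
split=> [[m m1 ->]|[Lv dv]].
  rewrite sumE; split=> i; rewrite ip_coroot_alpha_weight //.
  by rewrite -[0]/(0%:~R) ltr_int; exact: m1.
exists (fun i => `|Num.floor (ip (coroot (alpha i)) v)|%N) => [i|].
  rewrite absz_gt0 -(intr_eq0 R) floorK; last exact: Lv.
  by rewrite gt_eqF.
rewrite sumE [LHS](weight_latticeE Lv); apply: eq_bigr => i _; congr (_%:~R *: _).
by rewrite gez0_abs // floor_ge0 ltW.
Qed.

Definition in_box M v := all (fun a => `|ip (coroot a) v| <= M%:R) Dplus.

Lemma in_boxP M v : reflect (forall a, a \in Delta -> `|ip (coroot a) v| <= M%:R) (in_box M v).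
Proof.
apply: (iffP allP) => H a; last by move=> /mem_Dplus[aD _]; exact: H.
move=> aD; have [pa|na] := pos_or_neg aD; first by apply: H; apply/mem_Dplus.
rewrite -normrN -ipNl -corootN; apply: H; apply/mem_Dplus; split => //; exact: oppD.
Qed.

Definition box_weight M (g : {ffun 'I_r -> 'I_(2 * M).+1}) : V := weight (fun i => sym_idx (g i)).

(** The bound is imposed at all roots for the sake of Weyl stability. The coordinates of a weight
    are its pairings with the simple coroots, so enumerating coordinates up to [M] misses
    nothing. *)
Definition box M : {fset V} :=
  [fset box_weight g | g : {ffun 'I_r -> 'I_(2 * M).+1} & in_box M (box_weight g)]%fset.

Lemma sym_idx_surj M (n : int) : (`|n| <= M)%N -> exists j : 'I_(2 * M).+1, sym_idx j = n.
Proof.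
move=> nM; have nj : (absz (n + M%:Z)%R < (2 * M).+1)%N by lia.
by exists (Ordinal nj); rewrite /sym_idx /=; lia.
Qed.

Lemma normz_le_nat (n : int) M : (`|n%:~R : R| <= M%:R) = (`|n| <= M)%N.
Proof. by rewrite -intr_norm -abszE -pmulrn ler_nat. Qed.

Lemma mem_box M v : reflect (weight_lattice v /\ in_box M v) (v \in box M).
Proof.
apply: (iffP idP) => [/imfsetP[g /= gM ->]|[Lv vM]].
  by split=> // i; rewrite ip_coroot_alpha_weight.
have H i : exists j : 'I_(2 * M).+1, sym_idx j = Num.floor (ip (coroot (alpha i)) v).
  apply: sym_idx_surj; rewrite -normz_le_nat floorK; last exact: Lv.
  by move/in_boxP: vM; apply; exact: alphaD.
have [h Eh] := choice H.
have Ev : v = box_weight (finfun h).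
  by rewrite [LHS](weight_latticeE Lv); apply: eq_bigr => i _; rewrite ffunE Eh.
by apply/imfsetP; exists (finfun h) => //=; rewrite inE /= -Ev.
Qed.

Lemma box_reflection M i v : v \in box M -> reflection (alpha i) v \in box M.
Proof.
move=> /mem_box[Lv /in_boxP vM].
have E a : a \in Delta -> ip (coroot a) (reflection (alpha i) v) =
  ip (coroot (reflection (alpha i) a)) v.
  move=> aD; rewrite coroot_reflection ?alphaD //.
  by rewrite -{1}(reflectionK (alphaD i) (coroot a)) ip_reflection ?alphaD.
apply/mem_box; split=> [j|].
  by rewrite E ?alphaD //; apply: weight_lattice_root => //; rewrite reflectionD ?alphaD.
by apply/in_boxP => a aD; rewrite E // vM // reflectionD ?alphaD.
Qed.

(** Two truncations cut out the box: the index range bounds the pairings with the simple coroots,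
    the support of [cos_coef] those with the remaining positive ones. *)
Lemma fourier_lattice_sum_box M :
  fourier_lattice_sum N k (fun i => k (alpha i)) coroot_coef M = \sum_(v <- box M) weight_term v.
Proof.
rewrite big_imfset /=; last first.
  move=> g g' _ _ /weight_inj E; apply/ffunP => i; have /= := E i; rewrite /sym_idx => E'.
  by apply: ord_inj; lia.
rewrite big_filter big_mkcond big_enum /=; apply: eq_bigr => g _.
have ND a : a \in N -> a \in Delta by rewrite mem_nonsimple => /andP[/mem_Dplus[]].
have boxE : in_box M (box_weight g) = all (fun a => `|ip (coroot a) (box_weight g)| <= M%:R) N.
  rewrite /in_box (perm_all _ perm_Dplus) all_cat; apply: andb_idr => _.
  apply/allP => _ /tnthP[i ->]; rewrite ip_coroot_alpha_weight normz_le_nat.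
  by have := ltn_ord (g i); rewrite /= /sym_idx; lia.
rewrite boxE; case: ifP => [/allP Hall|/negbT].
  rewrite /weight_term big_Dplus mulrC; congr (_ * _).
    apply: eq_big_seq => a aN; have := Hall a aN.
    by rewrite ip_coroot_weight ?ND // normz_le_nat /cos_coef => ->.
  by apply: eq_bigr => i _; rewrite ip_coroot_alpha_weight.
move=> /allPn[a aN /= aM].
rewrite [X in _ * X](_ : _ = 0) ?mulr0 //.
apply/eqP; rewrite prodf_seq_eq0; apply/hasP; exists a => //=.
by move: aM; rewrite ip_coroot_weight ?ND // normz_le_nat /cos_coef => /negbTE ->.
Qed.

Definition dominant_box_sum M : R := \sum_(v <- box M | `[< dominant v >]) weight_term v.

Lemma lattice_sum_weyl M :
  fourier_lattice_sum N k (fun i => k (alpha i)) coroot_coef M =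
    (weyl_order ip Delta)%:R * dominant_box_sum M.
Proof.
rewrite fourier_lattice_sum_box; apply: weyl_sum => [i u|i u|u a aD].
- exact: box_reflection.
- exact: weight_term_reflection.
- exact: weight_term_irregular.
Qed.

Lemma weyl_order_gt0 : (0 < weyl_order ip Delta)%N.
Proof.
rewrite /weyl_order cardfs_gt0; apply/fset0Pn; exists \1%VF.
by rewrite mem_weyl_fset; apply/asboolP; exact: weyl_id.
Qed.

(** The fractional part around [x a] brings the first product into the algebra of fractional parts.
    On the unit cube it only replaces the argument 1 by 0, where a Bernoulli polynomial of even
    degree has the same value. *)
Definition fourier_integrand (x : V -> R) : R :=
  (\prod_(a <- N) bernoulli_fun (2 * k a) (frac_part (x a))) *
  \prod_(i < r) bernoulli_fun (2 * k (alpha i)) (frac_part (- \sum_(a <- N) x a *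
    (coroot_coef a i)%:~R)).

Lemma nonsimpleD a : a \in N -> a \in Delta.
Proof. by rewrite mem_nonsimple => /andP[/mem_Dplus[]]. Qed.

Lemma bernoulli_rootsE :
  bernoulli_roots ip Delta Psi lambda (fun a => 2 * k a)%N =
    iterated_integral N fourier_integrand.
Proof.
apply: eq_iterated_integral => x x01; congr (_ * _).
  apply: eq_big_seq => a /nonsimpleD /k_gt0 ka.
  have /andP[x0] := x01 a; rewrite le_eqVlt => /predU1P[->|x1]; last by rewrite frac_part_id ?x0.
  rewrite bernoulli_fun1 (_ : (2 * k a == 1)%N = false); last by lia.
  by rewrite addr0 -[X in frac_part X]addr0 (frac_partD_int 1) frac_part_id // lexx ltr01.
apply: eq_bigr => i _; congr (bernoulli_fun _ (frac_part (- _))).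
by apply: eq_big_seq => a /nonsimpleD aD; rewrite coroot_coefE.
Qed.

Lemma fourier_integrand_alg : frac_alg N (fun y : R => exists q, y = ratr q) fourier_integrand.
Proof.
have Pq (q : rat) : exists q', ratr q = ratr q' :> R by exists q.
have PD (y z : R) : (exists q, y = ratr q) -> (exists q, z = ratr q) -> exists q, y + z = ratr q.
  by move=> [q ->] [q' ->]; exists (q + q'); rewrite rmorphD.
have PM (y z : R) : (exists q, y = ratr q) -> (exists q, z = ratr q) -> exists q, y * z = ratr q.
  by move=> [q ->] [q' ->]; exists (q * q'); rewrite rmorphM.
have P0 : exists q, 0 = ratr q :> R by exists 0; rewrite rmorph0.
apply: frac_algM.
  apply: (frac_alg_prod Pq) => a aN; apply: (frac_alg_poly Pq).
  rewrite (_ : (fun x => _) = (fun x => frac_part (affine N 0 (fun b => (b == a)%:R) x))).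
    exact: frac_alg_frac.
  apply/funext => x; rewrite /affine add0r (bigD1_seq a) ?fset_uniq //= eqxx rmorph1 mul1r.
  by rewrite big1 ?addr0 // => b /negbTE ->; rewrite rmorph0 mul0r.
apply: (frac_alg_prod Pq) => i _; apply: (frac_alg_poly Pq).
rewrite (_ : (fun x => _) = (fun x => frac_part (affine N 0 (fun b =>
  - (coroot_coef b i)%:~R) x))).
  exact: frac_alg_frac.
apply/funext => x; rewrite /affine add0r -sumrN; congr frac_part; apply: eq_bigr => b _.
by rewrite rmorphN /= ratr_int mulNr mulrC.
Qed.

Local Notation const := (\prod_(a <- Dplus) bernoulli_const R (k a)).
Local Notation bern := (bernoulli_roots ip Delta Psi lambda (fun a => 2 * k a)%N).
(** The limit forced on the sums over the chamber by the identities at the finite levels. *)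
Definition zeta_limit : R := bern / (const * (weyl_order ip Delta)%:R).

Lemma prod_bernoulli_const_neq0 : const != 0.
Proof.
rewrite prodf_seq_neq0; apply/allP => a _ /=.
have f0 : (2 * k a)`!%:R != 0 :> R by rewrite pnatr_eq0 -lt0n fact_gt0.
have p0 : 2 * pi != 0 :> R by rewrite mulf_neq0 ?pnatr_eq0 // gt_eqF ?pi_gt0.
by rewrite /bernoulli_const oppr_eq0 !mulf_eq0 signr_eq0 invr_eq0 !negb_or f0 expf_neq0.
Qed.

Lemma dominant_box_sum_limit : exists2 C : R, 0 <= C & forall M,
  `|zeta_limit - dominant_box_sum M| <= C / M.+1%:R.
Proof.
have okF : iint_ok N fourier_integrand.
  apply: (frac_alg_iint_ok (N := N)) => //; try exact: fset_uniq.
  (* The rational derivation is replayed with arbitrary real constants. *)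
  elim: fourier_integrand_alg => [c0 _|q0 q _|F G _ AF _ AG|F G _ AF _ AG].
  - exact: (frac_alg_cst N (c0 := c0)).
  - exact: frac_alg_frac.
  - exact: frac_algD.
  - exact: frac_algM.
have [C C0 HC] := bernoulli_integral_approx (fset_uniq N)
  (fun a aN => k_gt0 (nonsimpleD aN)) (fun i => k_gt0 (alphaD i)) okF.
have w0 : (weyl_order ip Delta)%:R != 0 :> R by rewrite pnatr_eq0 -lt0n weyl_order_gt0.
set D := const * (weyl_order ip Delta)%:R; have D0 : D !=
  0 by rewrite mulf_neq0 ?prod_bernoulli_const_neq0.
exists (C / `|D|) => [|M]; first by rewrite divr_ge0.
have := HC M; rewrite lattice_sum_weyl -bernoulli_rootsE -big_Dplus mulrA -/D.
move=> H; have -> : zeta_limit - dominant_box_sum M = (bern - D * dominant_box_sum M) / D.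
  by rewrite /zeta_limit -/D mulrBl [D * _]mulrC mulfK.
by rewrite normrM normfV [leRHS]mulrAC ler_wpM2r ?invr_ge0.
Qed.

Lemma box_mono M M' : (M <= M')%N -> {subset box M <= box M'}.
Proof.
move=> MM' v /mem_box[Lv /in_boxP vM]; apply/mem_box; split => //; apply/in_boxP => a aD.
by rewrite (le_trans (vM a aD)) // ler_nat.
Qed.

Lemma in_some_box v : weight_lattice v -> exists M, v \in box M.
Proof.
move=> Lv; exists (\sum_(a <- Dplus) `|Num.floor (ip (coroot a) v)|)%N.
apply/mem_box; split => //; apply/allP => a aDp.
have [aD _] := mem_Dplus _ aDp.
rewrite -[ip _ _](floorK (weight_lattice_root Lv aD)) normz_le_nat.
by rewrite (bigD1_seq a) ?fset_uniq //= leq_addr.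
Qed.

Definition dominant_term v : R := if v \in regular_dominant_weights lambda then weight_term v
  else 0.

Lemma dominant_termE v : weight_lattice v -> dominant_term v =
  if `[< dominant v >] then weight_term v else 0.
Proof.
move=> Lv; rewrite /dominant_term; congr (if _ then _ else _); apply/idP/asboolP =>
  [/set_mem/regular_dominant_weightsE[]//|dv].
by apply/mem_set/regular_dominant_weightsE.
Qed.

Lemma dominant_term_ge0 v : 0 <= dominant_term v.
Proof. by rewrite /dominant_term; case: ifP => // _; exact: weight_term_ge0. Qed.

Lemma dominant_box_sumE M : dominant_box_sum M = \sum_(v <- box M) dominant_term v.
Proof.
rewrite /dominant_box_sum big_mkcond; apply: eq_big_seq => v /mem_box[Lv _].
by rewrite dominant_termE.
Qed.

Lemma le_sum_dominant_term (A B : {fset V}) : {subset A <=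
  B} -> \sum_(v <- A) dominant_term v <= \sum_(v <- B) dominant_term v.
Proof.
move=> AB; rewrite [leRHS](big_fsetID _ (fun v => v \in A)) /=.
rewrite (_ : [fset v in B | v \in A]%fset = A); last first.
  by apply/fsetP => v; rewrite !inE /= andb_idl //; exact: AB.
by rewrite lerDl sumr_ge0 // => v _; exact: dominant_term_ge0.
Qed.

(** The terms are nonnegative and the weights in [A] lie in some box, whose sum exceeds the limit by
    at most [C / (M + 1)]; a large [M] makes this excess arbitrarily small. *)
Lemma sum_dominant_term_le_limit (A : {fset V}) : \sum_(v <- A) dominant_term v <= zeta_limit.
Proof.
have [M0 HM0] : exists M, forall v, v \in A -> weight_lattice v -> v \in box M.
  (* A box is chosen for each weight, and level 0 for vectors outside the lattice; the sum of the
     levels over [A] dominates each of them. *)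
  have [h Hh] := choice (fun v => match pselect (weight_lattice v) with
     | left Lv => let: ex_intro M HM := in_some_box Lv in ex_intro (fun M =>
       weight_lattice v -> v \in box M) M (fun _ => HM)
     | right nL => ex_intro (fun M => weight_lattice v -> v \in box M) 0%N (fun L =>
       False_ind _ (nL L)) end).
  exists (\sum_(v <- A) h v)%N => v vA Lv; apply: (@box_mono (h v)); last exact: Hh.
  by rewrite (bigD1_seq v) ?fset_uniq //= leq_addr.
have [C C0 HC] := dominant_box_sum_limit.
apply/ler_addgt0Pr => e e0.
pose M := maxn M0 (Num.truncn (C / e)).
have Ce : C / M.+1%:R <= e.
  rewrite ler_pdivrMr // mulrC -ler_pdivrMr // (le_trans (ltW (truncnS_gt _))) // ler_nat.
  by rewrite ltnS leq_maxr.
have AM : \sum_(v <- A) dominant_term v <= dominant_box_sum M.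
  rewrite dominant_box_sumE [leLHS](big_fsetID _ (fun v => v \in box M)) /=
    [X in _ + X]big1_fset ?addr0.
    by apply: le_sum_dominant_term => v; rewrite !inE => /andP[].
  move=> v; rewrite !inE /= => /andP[vA vM] _; rewrite /dominant_term; case: ifP => // /set_mem.
  move=> /regular_dominant_weightsE[Lv _]; case/negP: vM.
  by apply: (box_mono (leq_maxl _ _)); exact: HM0.
rewrite (le_trans AM) // -lerBlDl (le_trans _ Ce) // (le_trans _ (HC M)) //.
by rewrite distrC ler_norm.
Qed.

Lemma cpow_natN (x : R) n : 0 < x -> cpow x (- n%:R) = (x ^- n)%:C%C.
Proof.
move=> x0; have -> : - n%:R = (- n%:R : R)%:C%C by rewrite rmorphN rmorph_nat.
by rewrite /cpow /= mul0r cos0 sin0 powRN powR_mulrn ?ltW // mulr1.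
Qed.

(** Once a finite set contains [box M], its partial sum lies between the sum over that box and the
    limit, so the unordered sum converges. *)
Lemma zeta_roots_limit :
  zeta_roots ip Delta Psi lambda (fun a => (2 * k a)%:R) = zeta_limit%:C%C.
Proof.
have FF := @summability.totally_filter V.
rewrite /zeta_roots /summability.sum; apply: (@cvg_lim R[i]^o); first exact: norm_hausdorff.
have E v : (if v \in regular_dominant_weights lambda then
    \prod_(a <- Dplus) cpow (ip (coroot a) v) (- (2 * k a)%:R) else 0) = (dominant_term v)%:C%C.
  rewrite /dominant_term; case: ifP => [/set_mem/regular_dominant_weightsE[Lv dv]|//].
  rewrite /weight_term rmorph_prod; apply: eq_big_seq => a aDp; rewrite cpow_natN //.
  have [aD pa] := mem_Dplus _ aDp.
  by rewrite corootE mulr_gt0 ?divr_gt0 ?root_sqr_gt0 //; apply/(pos_iff aD dv).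
apply/cvgrPdist_lt => e e0.
have [C C0 HC] := dominant_box_sum_limit.
(* In the order on [R[i]] a positive number has imaginary part 0. *)
have eR : e = (complex.Re e)%:C%C by apply/eqP; rewrite eq_complex /= eqxx /=; move: e0;
  rewrite ltcE /= => /andP[/eqP->].
have er0 : 0 < complex.Re e by move: e0; rewrite ltcE => /andP[].
pose M := Num.truncn (C / complex.Re e).
have Ce : C / M.+1%:R < complex.Re e.
  by rewrite ltr_pdivrMr // mulrC -ltr_pdivrMr // truncnS_gt.
exists (box M) => // A /= /fsubsetP AM.
set S := summability.partial_sum _ A.
have -> : S = (\sum_(v <- A) dominant_term v)%:C%C.
  rewrite /S /summability.partial_sum rmorph_sum big_seq_fsetE.
  by apply: eq_bigr => v _; exact: E.
rewrite -rmorphB /= normc_def /= expr0n /= addr0 sqrtr_sqr eR ltcR.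
rewrite ger0_norm ?subr_ge0 ?sum_dominant_term_le_limit //.
apply: le_lt_trans Ce; apply: le_trans (HC M); apply: (le_trans _ (ler_norm _)).
by rewrite lerB // dominant_box_sumE le_sum_dominant_term.
Qed.

Lemma bernoulli_roots_rational : exists q, bern = ratr q.
Proof.
rewrite bernoulli_rootsE; exact: frac_alg_rational (fset_uniq N) fourier_integrand_alg.
Qed.

End Zeta.
End Roots.

(** * Constants, root lengths and the final formula *)

Lemma prod_seqN (S : comPzRingType) (I : Type) (s : seq I) (F : I -> S) :
  \prod_(i <- s) - F i = (-1) ^+ size s * \prod_(i <- s) F i.
Proof.
elim: s => [|i s IH]; first by rewrite !big_nil mulr1.
by rewrite !big_cons IH /= exprS mulN1r !mulNr mulrCA.
Qed.

(** The minus sign, one for each positive root, is the origin of the sign in the zeta formula. *)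
Lemma bernoulli_constV (R : realType) k :
  ((bernoulli_const R k)^-1)%:C%C =
  - ((2 * pi%:C%C * 'i%C) ^+ (2 * k) / ((2 * k)`!)%:R).
Proof.
have E : (2 * pi%:C%C * 'i%C : R[i]) ^+ (2 * k) = ((-1) ^+ k * (2 * pi) ^+ (2 * k))%:C%C.
  by rewrite exprMn [in 'i%C ^+ _]exprM sqr_i rmorphM rmorphXn rmorphN1 mulrC rmorphXn
    rmorphM rmorph_nat.
rewrite E -(rmorph_nat (real_complex R)) -fmorph_div -rmorphN; congr (_%:C%C).
by rewrite /bernoulli_const invrN !invfM invrK invr_sign mulrAC.
Qed.

Lemma sum_root_lengths (R : realType) (V : vectType R) (ip : {dot V for @idfun R})
    (Delta A : {fset V}) (kl : R -> nat) : {subset A <= Delta} ->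
  (\sum_(l <- root_lengths ip Delta) kl l * #|` roots_of_length ip A l| =
   \sum_(a <- A) kl (vlength ip a))%N.
Proof.
move=> AD; under eq_bigr => l _ do rewrite card_fset_sum1 -big_fset_condE big_mkcond
  big_distrr /=.
rewrite exchange_big /=; apply: eq_big_seq => a aA.
rewrite (bigD1_seq (vlength ip a)) ?fset_uniq //=; last by apply: in_imfset; exact: AD.
rewrite eqxx /= muln1 big1 ?addn0 // => l /negbTE la; rewrite eq_sym la muln0 //.
Qed.

Theorem theorem4p6 (R : realType) (V : vectType R) (ip : {dot V for @idfun R})
    (r : nat) (Delta : {fset V}) (Psi lambda : r.-tuple V)
    (kl : R -> nat) (k : V -> nat)
    (dimV : \dim {:V} = r)
    (root_Delta : root_system ip Delta)
    (irr_Delta : irreducible_roots ip Delta)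
    (fund_Psi : fundamental_system Delta Psi)
    (fund_lambda : fundamental_weights ip Psi lambda)
    (k_length : forall a, a \in Delta -> k a = kl (vlength ip a))
    (k_ge1 : forall a, a \in Delta -> (1 <= k a)%N) :
  let Dplus := positive_roots Delta Psi in
  let zeta_2k := zeta_roots ip Delta Psi lambda (fun a => (2 * k a)%:R) in
  zeta_2k =
    (-1) ^+ #|` Dplus| / (weyl_order ip Delta)%:R *
    (\prod_(a <- Dplus)
       ((2 * pi%:C%C * 'i%C) ^+ (2 * k a) / ((2 * k a)`!)%:R)) *
    (bernoulli_roots ip Delta Psi lambda (fun a => 2 * k a)%N)%:C%C
  /\ exists q : rat,
    zeta_2k = ratr q *
      (pi%:C%C) ^+ (2 * \sum_(l <- root_lengths ip Delta)
                          kl l * #|` roots_of_length ip Dplus l|)%N.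
Proof.
move=> Dplus zeta_2k.
(* Reflections preserve lengths, so [k] is constant on Weyl orbits, as the invariance of the summand
   requires. *)
have k_reflection a b : a \in Delta -> b \in Delta -> k (reflection ip a b) = k b.
  move=> aD bD; rewrite !k_length ?(reflectionD root_Delta) //; congr kl.
  by rewrite /vlength (ip_reflection root_Delta).
have zetaE := zeta_roots_limit root_Delta fund_Psi fund_lambda k_ge1 k_reflection.
have DD : {subset Dplus <= Delta} by move=> a /mem_Dplus[].
set B := bernoulli_roots _ _ _ _ _.
have limitE : zeta_2k = (B * (\prod_(a <- Dplus) (bernoulli_const R (k a))^-1) / (weyl_order
  ip Delta)%:R)%:C%C.
  by rewrite /zeta_2k zetaE /zeta_limit prodfV invfM mulrA.
split.
  rewrite limitE !rmorphM /= fmorphV rmorph_nat rmorph_prod.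
  rewrite (eq_bigr _ (fun a _ => bernoulli_constV R (k a))) prod_seqN.
  by rewrite mulrC [in RHS]mulrC; ring.
have [q Bq] := bernoulli_roots_rational root_Delta fund_Psi fund_lambda k_ge1.
(* The rational factor left of the inverse Bernoulli constant after splitting off
   [pi ^+ (2 * k a)]. *)
pose c a : rat := - ((-1) ^+ k a * 2 ^+ (2 * k a) / ((2 * k a)`!)%:R).
exists (q * (\prod_(a <- Dplus) c a) / (weyl_order ip Delta)%:R).
have -> : (2 * \sum_(l <- root_lengths ip Delta) kl l * #|` roots_of_length ip Dplus l| =
  \sum_(a <- Dplus) 2 * k a)%N.
  rewrite sum_root_lengths // big_distrr; apply: eq_big_seq => a /DD aD.
  by rewrite -k_length.
have constV a : (bernoulli_const R (k a))^-1 = ratr (c a) * pi ^+ (2 * k a).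
  rewrite /bernoulli_const /c invrN !invfM invrK invr_sign rmorphN fmorph_div rmorphM.
  by rewrite rmorph_sign rmorphXn !rmorph_nat exprMn; ring.
have prodV : \prod_(a <- Dplus) (bernoulli_const R (k a))^-1 =
    ratr (\prod_(a <- Dplus) c a) * pi ^+ (\sum_(a <- Dplus) 2 * k a)%N.
  by rewrite rmorph_prod expr_sum -big_split; apply: eq_bigr => a _; exact: constV.
rewrite limitE /B Bq prodV -(fmorph_rat (real_complex R)) -rmorphXn -rmorphM; congr (_%:C%C).
by rewrite !rmorphM fmorphV rmorph_nat; ring.
Qed.
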